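(* Let $\mu\in\mathcal P$, let $\rho:=C_{k,\mathrm{ovl}}\cdot\kappa$, let $\overline{\mathfrak V}$ be an arbitrary linear subspace of $\mathfrak V$, and let $\overline{\mathfrak u}_\mu=(u_H,u^{\mathrm f}_{T_1},\dots,u^{\mathrm f}_{T_{|\mathcal T_H|}})$ be the solution of the residual-minimization problem $$\overline{\mathfrak u}_\mu:=\operatorname*{arg\,min}_{\mathfrak u\in\overline{\mathfrak V}}\ \sup_{0\ne\mathfrak v\in\mathfrak V}\frac{\mathfrak F(\mathfrak v)-\mathfrak B_\mu(\mathfrak u,\mathfrak v)}{|||\mathfrak v|||_1}.$$ Let $\mathfrak u_\mu\in\mathfrak V$ be the two-scale solution. Then $$|||\mathfrak u_\mu-\overline{\mathfrak u}_\mu|||_{a,\mu}\le\sqrt5\,\gamma_k^{-1}\beta^{1/2}\min_{\overline{\mathfrak v}\in\overline{\mathfrak V}}|||\mathfrak u_\mu-\overline{\mathfrak v}|||_{a,\mu},$$ and, writing $\overline{\mathfrak v}=(\overline v_H,\overline v^{\mathrm f}_{T_1},\dots,\overline v^{\mathrm f}_{T_{|\mathcal T_H|}})$, $$\Big(\|u_{H,k,\mu}-u_H\|_1^2+\rho\sum_{T\in\mathcal T_H}\|\mathcal Q^T_{k,\mu}(u_H)-u_T^{\mathrm f}\|_1^2\Big)^{1/2}$$ $$\le\sqrt{15}\,C_{\mathcal I_H}(C_{k,\mathrm{ovl}}+1)^{1/2}\kappa^{1/2}\gamma_k^{-1}\beta^{1/2}\min_{\overline{\mathfrak v}\in\overline{\mathfrak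 V}}\Big(\|u_{H,k,\mu}-\overline v_H\|_1^2+\rho\sum_{T\in\mathcal T_H}\|\mathcal Q^T_{k,\mu}(\overline v_H)-\overline v_T^{\mathrm f}\|_1^2\Big)^{1/2}.$$
   Context: **Problem.** $\mathcal P\subset\mathbb R^p$ is a parameter set, $\Omega\subset\mathbb R^d$ a bounded Lipschitz domain, $V:=H^1_0(\Omega)$, $f\in L^2(\Omega)$, and for each $\mu\in\mathcal P$, $A_\mu\in L^\infty(\Omega,\mathbb R^{d\times d})$ is symmetric with $\alpha|\xi|^2\le\xi^TA_\mu(x)\xi\le\beta|\xi|^2$ for all $\mu\in\mathcal P$, $x\in\Omega$, $\xi\in\mathbb R^d$, where $0<\alpha\le\beta<\infty$ are fixed; $\kappa:=\beta/\alpha$. Set $a_\mu(u,v):=\int_\Omega (A_\mu\nabla u)\cdot\nabla v\,dx$, $F(v):=\int_\Omega fv\,dx$, and for $T\subseteq\Omega$ let $a_\mu^T(u,v):=\int_T(A_\mu\nabla u)\cdot\nabla v\,dx$. Norms on $V$: $\|v\|_1^2:=\int_\Omega|\nabla v|^2dx$, $\|v\|_{a,\mu}^2:=\int_\Omega|A_\mu^{1/2}\nabla v|^2dx$. **Discretization.** $V_h\subset V$ is a (finite-dimensional) conforming finite-element space over a shape-regular mesh $\mathcal T_h$ of $\Omega$; $\mathcal T_H=\{T_1,\dots,T_{|\mathcal T_H|}\}$ is a coarse mesh aligned with $\mathcal T_h$; $V_H:=V_h\cap\mathcal P_1(\mathcal T_H)\neq\{0\}$, where $\mathcal P_1(\mathcal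 T_H)$ denotes the continuous, $\mathcal T_H$-piecewise affine functions. For $\omega\subseteq\Omega$, $U_0(\omega):=\omega$ and $U_{k+1}(\omega):=\operatorname{Int}\big(\overline{\bigcup\{T\in\mathcal T_H: \overline{U_k(\omega)}\cap\overline T\ne\emptyset\}}\big)$. Fix an integer $k\ge0$ and set $C_{k,\mathrm{ovl}}:=\max_{x\in\Omega}\#\{T\in\mathcal T_H: x\in U_k(T)\}$. $\mathcal I_H:V_h\to V_H$ is linear with $\mathcal I_H(v_H)=v_H$ for $v_H\in V_H$ and $\|\mathcal I_H(v_h)\|_1\le C_{\mathcal I_H}\|v_h\|_1$ for $v_h\in V_h$. **Correctors.** $V_h^{\mathrm f}:=\ker\mathcal I_H$ and $V^{\mathrm f}_{h,k,T}:=V_h^{\mathrm f}\cap H^1_0(U_k(T))$ (functions extended by zero). For $v_h\in V_h$, $\mathcal Q^T_{k,\mu}(v_h)\in V^{\mathrm f}_{h,k,T}$ is the solution of $a_\mu(\mathcal Q^T_{k,\mu}(v_h),v^{\mathrm f})=a_\mu^T(v_h,v^{\mathrm f})$ for all $v^{\mathrm f}\in V^{\mathrm f}_{h,k,T}$. Set $\mathcal Q_{k,\mu}:=\sum_{T\in\mathcal T_H}\mathcal Q^T_{k,\mu}$. **PG--LOD solution.** $$\gamma_k:=\inf_{0\ne w_H\in V_H}\sup_{0\ne v_H\in V_H}\frac{a_\mu(w_H-\mathcal Q_{k,\mu}(w_H),v_H)}{\|w_H-\mathcal Q_{k,\mu}(w_H)\|_{a,\mu}\,\|v_H\|_1}.$$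 Standing assumptions: $\gamma_k>0$ and $\gamma_k\le\alpha^{1/2}$. $u_{H,k,\mu}\in V_H$ denotes the unique element with $a_\mu(u_{H,k,\mu}-\mathcal Q_{k,\mu}(u_{H,k,\mu}),v_H)=F(v_H)$ for all $v_H\in V_H$. **Two-scale objects.** $\mathfrak V:=V_H\oplus V^{\mathrm f}_{h,k,T_1}\oplus\cdots\oplus V^{\mathrm f}_{h,k,T_{|\mathcal T_H|}}$. For $\mathfrak u=(u_H,u^{\mathrm f}_{T_1},\dots,u^{\mathrm f}_{T_{|\mathcal T_H|}})$, $\mathfrak v=(v_H,v^{\mathrm f}_{T_1},\dots,v^{\mathrm f}_{T_{|\mathcal T_H|}})$ in $\mathfrak V$ and stabilization parameter $\rho$, $$\mathfrak B_\mu(\mathfrak u,\mathfrak v):=a_\mu\Big(u_H-\sum_{T\in\mathcal T_H}u^{\mathrm f}_T,\,v_H\Big)+\rho^{1/2}\sum_{T\in\mathcal T_H}\big(a_\mu(u_T^{\mathrm f},v_T^{\mathrm f})-a_\mu^T(u_H,v_T^{\mathrm f})\big),\qquad\mathfrak F(\mathfrak v):=F(v_H),$$ $$|||\mathfrak u|||_1^2:=\|u_H\|_1^2+\sum_{T\in\mathcal T_H}\|u_T^{\mathrm f}\|_1^2,\qquad |||\mathfrak u|||_{a,\mu}^2:=\Big\|u_H-\sum_{T\in\mathcal T_H}u_T^{\mathrm f}\Big\|_{a,\mu}^2+\rho\sum_{T\in\mathcal T_H}\|\mathcal Q^T_{k,\mu}(u_H)-u_T^{\mathrm f}\|_{a,\mu}^2.$$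 The two-scale solution $\mathfrak u_\mu\in\mathfrak V$ is the unique solution of $\mathfrak B_\mu(\mathfrak u_\mu,\mathfrak v)=\mathfrak F(\mathfrak v)$ for all $\mathfrak v\in\mathfrak V$; it equals $\big(u_{H,k,\mu},\mathcal Q^{T_1}_{k,\mu}(u_{H,k,\mu}),\dots,\mathcal Q^{T_{|\mathcal T_H|}}_{k,\mu}(u_{H,k,\mu})\big)$. *)

(* Defs.v *)
From HB Require Import structures.
From mathcomp Require Import all_boot all_order all_algebra.
From mathcomp Require Import all_classical all_reals all_analysis.
From mathcomp Require Import measurable_realfun.

Set Implicit Arguments.
Unset Strict Implicit.
Unset Printing Implicit Defensive.

Import Order.TTheory GRing.Theory Num.Theory.
Import numFieldNormedType.Exports.

Local Open Scope classical_set_scope.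
Local Open Scope ring_scope.

(* Matrices (in particular the points 'rV[R]_d of R^d) carry the Borel
   sigma-algebra. *)
HB.instance Definition _ (R : realType) (m n : nat) :=
  @isMeasurable.Build (sigma_display (@open 'M[R]_(m, n))) 'M[R]_(m, n)
    <<s @open 'M[R]_(m, n) >>
    (@sigma_algebra0 _ setT (@open 'M[R]_(m, n)))
    (@sigma_algebraC _ (@open 'M[R]_(m, n)))
    (@sigma_algebra_bigcup _ setT (@open 'M[R]_(m, n))).

Section lebesgue_rV.
Context {R : realType}.

Lemma measurable_fun_rV (d0 : measure_display) (T : measurableType d0) (n : nat)
    (f : T -> 'rV[R]_n) :
  (forall i, measurable_fun setT (fun x => f x 0 i)) -> measurable_fun setT f.
Proof.
move=> mf; apply: (measurability (@open 'rV[R]_n)) => // _ [U oU <-].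
rewrite setTI.
pose B (q : 'rV[rat]_n * rat) : set 'rV[R]_n :=
  ball (map_mx (@ratr R) q.1) (ratr q.2).
have mB q : measurable (f @^-1` B q).
  have [q0|q0] := leP (ratr q.2) (0 : R).
    rewrite (_ : _ @^-1` _ = set0)//; apply/seteqP; split => // x [] /=.
    by rewrite ltNge q0.
  rewrite (_ : _ @^-1` _ = \bigcap_(i in [set: 'I_n])
      ((fun x => f x 0 i) @^-1` ball (ratr (q.1 0 i) : R) (ratr q.2))).
    apply: fin_bigcap_measurable => // i _; rewrite -[X in measurable X]setTI.
    by apply: mf => //; exact: measurable_ball.
  apply/seteqP; split => x /=.
    by move=> [_ h] i _; have := h 0 i; rewrite !mxE.
  by move=> h; split => // i j; rewrite (ord1 i) !mxE; exact: h.
pose F q := if `[< B q `<=` U >] then f @^-1` B q else set0.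
rewrite (_ : _ @^-1` _ = \bigcup_q F q).
  apply: countable_bigcupT_measurable => [|q]; first exact: countableP.
  by rewrite /F; case: ifP => // _; exact: mB.
apply/seteqP; split => x /=; last first.
  by move=> [q _]; rewrite /F; case: ifPn => // /asboolP BU Bq; exact: BU.
move=> Ux.
have /nbhs_ballP[e /= e0 eU] : nbhs (f x) U by exact: open_nbhs_nbhs.
have [r /[!in_itv]/= /andP[r0 re]] : exists r : rat, ratr r \in `]0, (e / 2)[.
  by apply: rat_in_itvoo; rewrite divr_gt0.
have /choice[q qP] : forall i, exists q : rat, ball (f x 0 i) (ratr r) (ratr q : R).
  move=> i; have [|q] := @rat_in_itvoo R (f x 0 i - ratr r) (f x 0 i + ratr r).
    by rewrite ltrD2l gtrN.
  by exists q; rewrite ball_itv.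
exists (\row_i q i, r) => //; rewrite /F /B /=.
have fB : ball (map_mx (@ratr R) (\row_i q i)) (ratr r) (f x).
  by split => // i j; rewrite !mxE (ord1 i); exact/ball_sym.
case: ifPn => [//|/asboolP []]; move=> y By; apply: eU.
apply: (@le_ball _ _ _ (ratr r + ratr r)).
  by rewrite [leRHS]splitr lerD // ltW.
by apply: ball_triangle By; exact: ball_sym.
Qed.

Lemma measurable_coord (n : nat) (i : 'I_n) :
  measurable_fun setT (fun x : 'rV[R]_n => x 0 i).
Proof.
apply: (measurability _ (RGenOpens.measurableE R)) => _ [_ [a [b ->]] <-].
rewrite setTI; apply: sub_sigma_algebra.
by apply: open_comp; [move=> x _; exact: coord_continuous|exact: interval_open].
Qed.

Definition cons_rV (n : nat) (p : R * 'rV[R]_n) : 'rV[R]_n.+1 :=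
  row_mx (const_mx p.1 : 'rV_1) p.2.

Lemma measurable_cons_rV (n : nat) :
  measurable_fun [set: measurableTypeR R * 'rV[R]_n] (@cons_rV n).
Proof.
apply: measurable_fun_rV => i; have [j|j] := @split_ordP 1 n i => ->.
  rewrite (_ : (fun x => _) = fst); first exact: measurable_fst.
  by apply/funext => x; apply: etrans (row_mxEl _ _ _ _) _; rewrite mxE.
rewrite (_ : (fun x => _) = (fun x : 'rV[R]_n => x 0 j) \o snd).
  by apply: measurableT_comp; [exact: measurable_coord|exact: measurable_snd].
by apply/funext => x; exact: row_mxEr.
Qed.


Section step.
Variables (n : nat) (m : {sigma_finite_measure set 'rV[R]_n -> \bar R}).

Definition lebesgue_step : set 'rV[R]_n.+1 -> \bar R :=
  pushforward (lebesgue_measure \x m)%E (@cons_rV n).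


Let mstep : {measure set 'rV[R]_n.+1 -> \bar R} :=
  measure_function_pushforward__canonical__measure_function_Measure
    (lebesgue_measure \x m)%E (@measurable_cons_rV n).

HB.instance Definition _ := isMeasure.Build _ _ _ lebesgue_step
  (measure0 mstep) (measure_ge0 mstep) (@measure_semi_sigma_additive _ _ _ mstep).

Let lebesgue_step_sigma_finite : sigma_finite setT lebesgue_step.
Proof.
pose p (v : 'rV[R]_n.+1) : R := v 0 0.
pose t (v : 'rV[R]_n.+1) : 'rV[R]_n := \row_j v 0 (rshift 1 j).
have mp : measurable_fun setT (p : _ -> measurableTypeR R).
  exact: measurable_coord.
have mt : measurable_fun setT t.
  apply: measurable_fun_rV => j.
  rewrite (_ : (fun x => _) = (fun x : 'rV[R]_n.+1 => x 0 (rshift 1 j))).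
    exact: measurable_coord.
  by apply/funext => x; rewrite mxE.
pose g v := (p v, t v).
have mg : measurable_fun setT g by exact/measurable_fun_pairP.
have gK u : g (cons_rV u) = u.
  case: u => x v; congr pair.
    rewrite /p (_ : 0 = lshift n (0 : 'I_1)); last exact/val_inj.
    by rewrite /cons_rV; apply: etrans (row_mxEl _ _ _ _) _; rewrite mxE.
  by apply/rowP => j; rewrite mxE; exact: row_mxEr.
have [F UF FP] : sigma_finite setT (lebesgue_measure \x m)%E.
  have /sigma_finiteP[F [TF ndF Foo]] := sigma_finiteT (@lebesgue_measure R).
  have /sigma_finiteP[G [TG ndG Goo]] := sigma_finiteT m.
  exists (fun k => F k `*` G k).
    rewrite -setXTT TF TG predeqE => -[x y]; split.
      move=> [/= [i _ Fx] [k _ Gy]]; exists (maxn i k) => //; split.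
      - by move: x Fx; exact/subsetPset/ndF/leq_maxl.
      - by move: y Gy; exact/subsetPset/ndG/leq_maxr.
    by move=> [k _ []/= ? ?]; split; exists k.
  move=> k; have [? ?] := Foo k; have [? ?] := Goo k.
  split; first exact: measurableX.
  by rewrite product_measure1E// lte_mul_pinfty// ge0_fin_numE.
exists (fun k => g @^-1` F k).
  by rewrite -preimage_bigcup -UF preimage_setT.
move=> k; have [mF Foo] := FP k; split.
  by rewrite -[X in measurable X]setTI; exact: mg.
rewrite /lebesgue_step /pushforward (_ : _ @^-1` _ = F k)//.
by apply/funext => u; rewrite /preimage /= gK.
Qed.

HB.instance Definition _ := Measure_isSigmaFinite.Build _ _ _ lebesgue_step
  lebesgue_step_sigma_finite.

End step.

(* Lebesgue measure on R^n: the n-fold product of [lebesgue_measure]. *)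
Fixpoint lebesgue_rV (n : nat) : {sigma_finite_measure set 'rV[R]_n -> \bar R} :=
  if n is n'.+1 then lebesgue_step (lebesgue_rV n')
  else \d_(0 : 'rV[R]_0).

Lemma lebesgue_rV_box (n : nat) (a b : 'rV[R]_n) : (forall i, a 0 i <= b 0 i) ->
  lebesgue_rV n [set x | forall i, a 0 i <= x 0 i <= b 0 i]
  = (\prod_i (b 0 i - a 0 i))%:E.
Proof.
elim: n a b => [|n IH] a b ab.
  rewrite big_ord0 /= diracE mem_set//= => -[].
  by [].
rewrite /= /lebesgue_step /pushforward.
pose a' : 'rV[R]_n := \row_j a 0 (lift 0 j).
pose b' : 'rV[R]_n := \row_j b 0 (lift 0 j).
have c0 x (v : 'rV[R]_n) : cons_rV (x, v) 0 0 = x.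
  rewrite (_ : 0 = lshift n (0 : 'I_1)); last exact/val_inj.
  by apply: etrans (row_mxEl _ _ _ _) _; rewrite mxE.
have cS x (v : 'rV[R]_n) j : cons_rV (x, v) 0 (lift 0 j) = v 0 j.
  by rewrite (_ : lift 0 j = rshift 1 j); [exact: row_mxEr|exact/val_inj].
pose B := [set x : 'rV[R]_n | forall i, a' 0 i <= x 0 i <= b' 0 i].
rewrite [X in (_ \x _)%E X](_ : _ = `[a 0 0, b 0 0] `*` B); last first.
  apply/seteqP; split => -[x v] /=; rewrite in_itv /=.
    move=> h; split; first by have := h 0; rewrite c0.
    by move=> j; have := h (lift 0 j); rewrite cS !mxE.
  move=> [h1 h2] i; have [j ->|->] := unliftP 0 i; last by rewrite c0.
  by have := h2 j; rewrite cS !mxE.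
have mB : measurable B.
  rewrite (_ : B = \bigcap_(i in [set: 'I_n])
      ((fun x => x 0 i) @^-1` `[a' 0 i, b' 0 i])).
    apply: fin_bigcap_measurable => // i _; rewrite -[X in measurable X]setTI.
    by apply: measurable_coord => //; exact: measurable_itv.
  apply/seteqP; split => x h i /=; rewrite ?in_itv; first by move=> _; exact: h.
  by have := h i I; rewrite /= in_itv.
rewrite product_measure1E//= IH; last by move=> i; rewrite !mxE.
rewrite big_ord_recl lebesgue_measure_itv /= lte_fin.
under eq_bigr do rewrite !mxE.
have := ab 0; rewrite le_eqVlt => /predU1P[->|->]; last by rewrite EFinM.
by rewrite ltxx subrr mul0r mul0e.
Qed.

End lebesgue_rV.

Section euclidean.
Context {R : realType} {d : nat}.
Notation pt := 'rV[R]_d.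
Implicit Types (x y xi : pt) (D U Omega : set pt) (u f phi : pt -> R)
  (G : pt -> pt).

Definition dotv x y : R := (x *m y^T) 0 0.

(* [matv M xi] is the row vector holding the column vector M xi. *)
Definition matv (M : 'M[R]_d) xi : pt := xi *m M^T.

Definition partial (i : 'I_d) f x : R := 'D_(delta_mx 0 i) f x.

Definition smooth f : Prop :=
  forall s : seq 'I_d, let g := foldr partial f s in
    continuous g /\ (forall i x, derivable g x (delta_mx 0 i)).

Definition gradient f x : pt := \row_i partial i f x.

(* C_c^oo(U) *)
Definition test_function U phi : Prop :=
  [/\ smooth phi, compact (closure [set x | phi x != 0])
    & closure [set x | phi x != 0] `<=` U].

Definition L2 D f : Prop := (f \_ D) \in Lfun (lebesgue_rV d) 2%:E.
Definition Linfty D f : Prop := (f \_ D) \in Lfun (lebesgue_rV d) +oo%E.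

Definition ae_eq_on D f g : Prop :=
  {ae lebesgue_rV d, forall x, D x -> f x = g x :> R}.

Definition weak_gradient Omega u G : Prop :=
  forall phi, test_function Omega phi -> forall i,
    \int[lebesgue_rV d]_(x in Omega) (u x * partial i phi x)
    = - \int[lebesgue_rV d]_(x in Omega) (G x 0 i * phi x).

(* u is in H^1(Omega) and G represents its weak gradient. *)
Definition H1 Omega u G : Prop :=
  [/\ L2 Omega u, (forall i, L2 Omega (fun x => G x 0 i))
    & weak_gradient Omega u G].

(* u, with weak gradient G, lies in the closure of C_c^oo(U) with respect to the
   norm of H^1(Omega).  For u in H^1(Omega) this says u \in H^1_0(Omega) if
   U = Omega, and that u is the extension by zero of an element of H^1_0(U) if
   U is an open subset of Omega. *)
Definition H10 Omega U u G : Prop :=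
  forall eps : R, 0 < eps -> exists2 phi, test_function U phi &
    (\int[lebesgue_rV d]_(x in Omega)
       ((u x - phi x) ^+ 2
        + dotv (G x - gradient phi x) (G x - gradient phi x))%:E < eps%:E)%E.

Definition is_mesh Omega (N : nat) (T : 'I_N -> set pt) : Prop :=
  [/\ (forall i, [/\ open (T i), T i !=set0 & T i `<=` Omega]),
      trivIset setT T,
      closure Omega = \bigcup_i closure (T i)
    & forall i, lebesgue_rV d (closure (T i) `\` T i) = 0%E].

Definition shape_regular (sigma : R) (N : nat) (T : 'I_N -> set pt) : Prop :=
  forall i, exists (c : pt) (r : R),
    [/\ 0 < r, ball c r `<=` T i
      & forall x y, T i x -> T i y -> `|x - y| <= sigma * r].

Definition aligned (N M : nat) (TH : 'I_N -> set pt) (Th : 'I_M -> set pt) :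
    Prop := forall j, exists i, Th j `<=` TH i.

(* continuous, piecewise affine functions *)
Definition P1 Omega (N : nat) (T : 'I_N -> set pt) f : Prop :=
  {within closure Omega, continuous f}
  /\ forall i, exists (c : R) (g : pt), forall x, T i x -> f x = c + dotv g x.

(* U_k(omega) *)
Fixpoint patch (N : nat) (T : 'I_N -> set pt) (k : nat) (omega : set pt) :
    set pt :=
  if k is k'.+1 then
    (closure (\bigcup_(i in [set i |
        closure (patch T k' omega) `&` closure (T i) !=set0]) T i))°
  else omega.

(* max_{x in Omega} #{T : x in U_k(T)} *)
Definition ovl_count (N : nat) (T : 'I_N -> set pt) k x : nat :=
  #|[set i | `[< patch T k (T i) x >]]%SET|.

Definition ovl_const Omega (N : nat) (T : 'I_N -> set pt) k : nat :=
  \max_(j < N.+1 | `[< exists2 x, Omega x & ovl_count T k x = j >]) j.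

Definition is_sqrt (B M : 'M[R]_d) : Prop :=
  [/\ B^T = B, (forall xi, 0 <= dotv xi (matv B xi)) & B *m B = M].

Definition elliptic_field Omega (alpha beta : R) (A : pt -> 'M[R]_d) : Prop :=
  [/\ (forall i j, Linfty Omega (fun x => A x i j)),
      (forall x, Omega x -> (A x)^T = A x)
    & forall x, Omega x -> forall xi,
        alpha * dotv xi xi <= dotv xi (matv (A x) xi) <= beta * dotv xi xi].

(* A finite-dimensional subspace of H^1_0(Omega): [fval v] represents v and
   [fgrad v] its weak gradient, the representatives being chosen linearly in v. *)
Record H10_subspace Omega (Vh : vectType R) := {
  fval : Vh -> pt -> R;
  fgrad : Vh -> pt -> pt;
  fval_linear : forall a v w x, fval (a *: v + w) x = a * fval v x + fval w x;
  fgrad_linear : forall a v w x,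
    fgrad (a *: v + w) x = a *: fgrad v x + fgrad w x;
  fval_H1 : forall v, H1 Omega (fval v) (fgrad v);
  fval_H10 : forall v, H10 Omega Omega (fval v) (fgrad v);
  fval_inj : forall v, ae_eq_on Omega (fval v) (fun=> 0) -> v = 0 }.

(* On each element, the functions of Vh belong to a space spanned by finitely
   many smooth shape functions. *)
Definition finite_element Omega (Vh : vectType R) (S : H10_subspace Omega Vh)
    (M : nat) (Th : 'I_M -> set pt) : Prop :=
  forall K, exists (m : nat) (s : 'I_m -> pt -> R),
    (forall j, smooth (s j)) /\
    forall v, exists c : 'I_m -> R,
      ae_eq_on (Th K) (fval S v) (fun x => \sum_j c j * s j x).

End euclidean.

Definition lipschitz_domain {R : realType} {d : nat} (Omega : set 'rV[R]_d.+1) :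
    Prop :=
  [/\ open Omega, Omega !=set0, connected Omega
    & forall x0, (closure Omega `\` Omega) x0 ->
      exists (O : 'M[R]_d.+1) (g : 'rV[R]_d -> R) (r : R),
        [/\ O *m O^T = 1%:M, [lipschitz g y | y in setT], 0 < r
          & forall x, ball x0 r x ->
              let z := (x - x0) *m O in
              Omega x <-> g (col' ord0 z) < z 0 ord0]].

Definition is_minimum {R : realType} (E : set R) (m : R) : Prop :=
  E m /\ lbound E m.

Section lod.
Context {R : realType} {d N : nat} {Omega : set 'rV[R]_d} {Vh : vectType R}.
Variables (S : H10_subspace Omega Vh) (TH : 'I_N -> set 'rV[R]_d) (k : nat)
  (IH : Vh -> Vh) (A Ahalf : 'rV[R]_d -> 'M[R]_d) (f : 'rV[R]_d -> R)
  (Q : 'I_N -> Vh -> Vh) (rho : R).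
Notation leb := (lebesgue_rV d).
Implicit Types (v w : Vh) (D : set 'rV[R]_d).

Definition norm1 v : R :=
  Num.sqrt (\int[leb]_(x in Omega) dotv (fgrad S v x) (fgrad S v x)).

(* [Ahalf x] stands for A(x)^{1/2} *)
Definition norma v : R :=
  Num.sqrt (\int[leb]_(x in Omega)
    dotv (matv (Ahalf x) (fgrad S v x)) (matv (Ahalf x) (fgrad S v x))).

Definition aform_on D v w : R :=
  \int[leb]_(x in D) dotv (matv (A x) (fgrad S v x)) (fgrad S w x).
Definition aform v w : R := aform_on Omega v w.

Definition load v : R := \int[leb]_(x in Omega) (f x * fval S v x).

(* V_H = Vh `&` P_1(T_H) *)
Definition VH : set Vh :=
  [set v | exists2 p, P1 Omega TH p & ae_eq_on Omega (fval S v) p].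

(* V_{h,k,T}^f *)
Definition VfT (T : 'I_N) : set Vh :=
  [set v | IH v = 0 /\ H10 Omega (patch TH k (TH T)) (fval S v) (fgrad S v)].

Definition is_corrector : Prop := forall T v,
  VfT T (Q T v)
  /\ forall w, VfT T w -> aform (Q T v) w = aform_on (TH T) v w.

Definition Qsum v : Vh := \sum_T Q T v.

Definition is_PGLOD_solution v : Prop :=
  VH v /\ forall w, VH w -> aform (v - Qsum v) w = load w.

(* gamma_k; a real [sup]/[inf], where sets of quotients are bounded by the
   Cauchy-Schwarz inequality. *)
Definition gammak : R :=
  inf [set sup [set aform (w - Qsum w) v / (norma (w - Qsum w) * norm1 v)
               | v in [set v | VH v /\ v <> 0]]
      | w in [set w | VH w /\ w <> 0]].

(* Two-scale functions are pairs (u_H, (u_T)_T). *)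
Notation two_scale := (Vh * {ffun 'I_N -> Vh})%type.
Implicit Types uu vv : two_scale.

Definition VV : set two_scale :=
  [set uu : two_scale | VH uu.1 /\ forall T, VfT T (uu.2 T)].

Definition BB uu vv : R :=
  aform (uu.1 - \sum_T uu.2 T) vv.1
  + Num.sqrt rho
    * \sum_T (aform (uu.2 T) (vv.2 T) - aform_on (TH T) uu.1 (vv.2 T)).

Definition FF vv : R := load vv.1.

Definition nnorm1 uu : R :=
  Num.sqrt (norm1 uu.1 ^+ 2 + \sum_T norm1 (uu.2 T) ^+ 2).

Definition nnorma uu : R :=
  Num.sqrt (norma (uu.1 - \sum_T uu.2 T) ^+ 2
            + rho * \sum_T norma (Q T uu.1 - uu.2 T) ^+ 2).

Definition is_two_scale_solution uu : Prop :=
  VV uu /\ forall vv, VV vv -> BB uu vv = FF vv.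

Definition residual uu : R :=
  sup [set (FF vv - BB uu vv) / nnorm1 vv | vv in [set vv : two_scale | VV vv /\ vv <> 0]].

Definition is_residual_minimizer (VVbar : {vspace two_scale}) uu : Prop :=
  uu \in VVbar /\ forall vv, vv \in VVbar -> residual uu <= residual vv.

(* (||uHk - v_H||_1^2 + rho sum_T ||Q_T(v_H) - v_T||_1^2)^{1/2} *)
Definition err1 (uHk : Vh) vv : R :=
  Num.sqrt (norm1 (uHk - vv.1) ^+ 2
            + rho * \sum_T norm1 (Q T vv.1 - vv.2 T) ^+ 2).

End lod.

(* Main.v *)
Require Import Defs.
From mathcomp Require Import all_boot all_order all_algebra.
From mathcomp Require Import all_classical all_reals all_analysis.
From mathcomp Require Import ring lra measurable_realfun.

(** Write [e = u_H - sum_T u_T] for the function glued from a two-scale function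
    [u], and [r_T = Q_T u_H - u_T] for its defects; the energy norm of [u] is
    made of the energy norms of [e] and of the [r_T].  The corrector equations
    turn the two-scale form into
      [B(u, v) = a(e, v_H) - rho^(1/2) sum_T a(r_T, v_T)],
    so that Cauchy--Schwarz bounds [B] by [beta^(1/2)] times the energy norm of
    [u] and the [H^1] norm of [v] ([BB_bounded]).

    For the converse let [s] bound [B(u, v)] relative to the [H^1] norm of [v].
    Testing with the defects gives [alpha rho sum_T |r_T|_a^2 <= s^2].  For the
    glued function, [e = w + r] with [w = u_H - Q u_H] and [r = sum_T r_T].  The
    definition of [gamma] provides a normalized coarse [v_H] such that the
    functional [l = a(., v_H)] almost satisfies [l(w) >= gamma |w|_a], while
    [|l| <= beta^(1/2)].  The projection onto the line of [w] along the kernel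
    of [l] then has norm at most [beta^(1/2) / gamma]; a projection and its
    complement have the same norm, hence
      [gamma |e|_a <= |l(e)| + beta^(1/2) |r|_a]
    ([oblique_projection_bound]).  The finite overlap of the patches and the
    choice of [rho] bound [beta |r|_a^2] by [alpha rho sum_T |r_T|_a^2], so that
    both terms are at most [s].  Altogether
      [gamma^2 (|e|_a^2 + rho sum_T |r_T|_a^2) <= 4 s^2 + s^2],
    which is where [sqrt 5] comes from ([BB_inf_sup]).

    Since the exact solution [u_mu] solves the two-scale problem, the residual
    of [u] is the dual norm of [B(u_mu - u, .)]; minimizing it is therefore
    quasi-optimal in the energy norm ([residual_quasi_optimal]).  For the second
    estimate, the energy norm is compared with the error measure in [H^1]: in
    one direction [u_H] is the quasi-interpolant of [e], because the fine-scale
    functions lie in its kernel ([h1_le_energy]); in the other, [e] is split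
    into [u_H], its corrector and the defects ([energy_le_h1]).

    All norms involved are treated as seminorms of positive semidefinite forms,
    and the minima are attained because such a form has orthogonal projections
    onto finite-dimensional subspaces ([ex_best_approximation]).  Nondegeneracy
    enters only through [gamma > 0].

    The facts about integrals behind this are: the integrands are integrable;
    the fine-scale spaces are linear; the gradient of a function in such a space
    vanishes almost everywhere off the patch ([H10_gradient_off]); and a sum of
    gradients of which at most [C] are nonzero at almost every point has energy
    at most [C] times the sum of the energies ([aform_overlap]). *)

Set Implicit Arguments.
Unset Strict Implicit.
Unset Printing Implicit Defensive.

Import Order.TTheory GRing.Theory Num.Theory.
Import numFieldNormedType.Exports.

Local Open Scope classical_set_scope.
Local Open Scope ring_scope.

(** * Positive semidefinite forms *)

Section semi_inner.
Context {R : realType}.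

Definition semi_inner (V : lmodType R) (b : V -> V -> R) : Prop :=
  [/\ forall c u v w, b (c *: u + v) w = c * b u w + b v w,
      forall u v, b u v = b v u
    & forall u, 0 <= b u u].

Definition seminorm_of (V : lmodType R) (b : V -> V -> R) (u : V) : R :=
  Num.sqrt (b u u).

Section one_form.
Variables (V : lmodType R) (b : V -> V -> R) (bP : semi_inner b).
Implicit Types (u v w : V) (c : R).
Local Notation nb := (seminorm_of b).

Lemma formC u v : b u v = b v u. Proof. by case: bP. Qed.
Lemma form_ge0 u : 0 <= b u u. Proof. by case: bP. Qed.
Lemma formPl c u v w : b (c *: u + v) w = c * b u w + b v w.
Proof. by case: bP. Qed.
Lemma formDl u v w : b (u + v) w = b u w + b v w.
Proof. by have := formPl 1 u v w; rewrite scale1r mul1r. Qed.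
Lemma form0l w : b 0 w = 0.
Proof. by apply: (@addrI _ (b 0 w)); rewrite -formDl !addr0. Qed.
Lemma formZl c u w : b (c *: u) w = c * b u w.
Proof. by have := formPl c u 0 w; rewrite form0l !addr0. Qed.
Lemma formNl u w : b (- u) w = - b u w.
Proof. by rewrite -scaleN1r formZl mulN1r. Qed.
Lemma formBl u v w : b (u - v) w = b u w - b v w.
Proof. by rewrite formDl formNl. Qed.
Lemma form_suml (I : Type) (s : seq I) (P : pred I) (F : I -> V) w :
  b (\sum_(i <- s | P i) F i) w = \sum_(i <- s | P i) b (F i) w.
Proof. by elim/big_rec2: _ => [|i x y _ <-]; rewrite ?form0l ?formDl. Qed.
Lemma formDr u v w : b w (u + v) = b w u + b w v.
Proof. by rewrite !(formC w) formDl. Qed.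
Lemma form0r w : b w 0 = 0. Proof. by rewrite formC form0l. Qed.
Lemma formZr c u w : b w (c *: u) = c * b w u.
Proof. by rewrite !(formC w) formZl. Qed.
Lemma formNr u w : b w (- u) = - b w u.
Proof. by rewrite !(formC w) formNl. Qed.

Lemma form_sqrD u v : b (u + v) (u + v) = b u u + 2 * b u v + b v v.
Proof. by rewrite formDl !formDr (formC v u); ring. Qed.

Lemma form_sqrD3_le u v w :
  b (u + v + w) (u + v + w) <= 3 * (b u u + b v v + b w w).
Proof.
have h1 := form_ge0 (u - v); have h2 := form_ge0 (u - w).
have h3 := form_ge0 (v - w); move: h1 h2 h3.
rewrite !form_sqrD !formNl !formNr !formDl; lra.
Qed.

Lemma seminorm_of_ge0 u : 0 <= nb u. Proof. exact: sqrtr_ge0. Qed.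
Lemma sqr_seminorm_of u : nb u ^+ 2 = b u u.
Proof. by rewrite sqr_sqrtr ?form_ge0. Qed.

(** A null vector is orthogonal to everything: otherwise a large multiple of it
    would make the square of a sum negative. *)
Lemma form_null u w : b u u = 0 -> b u w = 0.
Proof.
move=> u0; apply/eqP/negP => /negP buw.
pose t := - (b w w + 1) / (2 * b u w).
have := form_ge0 (t *: u + w).
rewrite form_sqrD !formZl formZr u0.
have -> : 2 * (t * b u w) = - (b w w + 1) by rewrite /t; field; exact: buw.
lra.
Qed.

Lemma form_sqr_le u v : b u v ^+ 2 <= b u u * b v v.
Proof.
have [v0|v0] := eqVneq (b v v) 0.
  by rewrite formC (form_null _ v0) v0 expr0n mulr0.
have vp : 0 < b v v by rewrite lt_def v0 form_ge0.
rewrite -(ler_pM2l vp) -subr_ge0.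
apply: le_trans (form_ge0 (b v v *: u + (- b u v) *: v)) _.
by rewrite form_sqrD !formZl !formZr; lra.
Qed.

Lemma form_CS u v : `|b u v| <= nb u * nb v.
Proof.
rewrite -[leLHS]sqrtr_sqr -sqrtrM ?form_ge0//.
by rewrite ler_wsqrtr// form_sqr_le.
Qed.

Lemma seminorm_ofZ c u : nb (c *: u) = `|c| * nb u.
Proof.
by rewrite /seminorm_of formZl formZr mulrA -expr2 sqrtrM ?sqr_ge0// sqrtr_sqr.
Qed.

Lemma seminorm_ofN u : nb (- u) = nb u.
Proof. by rewrite -scaleN1r seminorm_ofZ normrN1 mul1r. Qed.

Lemma ler_seminorm_ofD u v : nb (u + v) <= nb u + nb v.
Proof.
rewrite -(@ler_pXn2r _ 2)// ?nnegrE ?addr_ge0 ?seminorm_of_ge0//.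
rewrite sqr_seminorm_of form_sqrD sqrrD !sqr_seminorm_of lerD2r lerD2l.
have := form_CS u v; have := ler_norm (b u v); lra.
Qed.

End one_form.

Lemma semi_innerD (V : lmodType R) (b1 b2 : V -> V -> R) :
  semi_inner b1 -> semi_inner b2 -> semi_inner (fun u v => b1 u v + b2 u v).
Proof.
move=> h1 h2; split.
- by move=> c u v w; rewrite (formPl h1) (formPl h2); ring.
- by move=> u v; rewrite (formC h1) (formC h2).
- by move=> u; rewrite addr_ge0 ?(form_ge0 h1) ?(form_ge0 h2).
Qed.

Lemma semi_innerZ (V : lmodType R) (b : V -> V -> R) (k : R) :
  0 <= k -> semi_inner b -> semi_inner (fun u v => k * b u v).
Proof.
move=> k0 h; split.
- by move=> c u v w; rewrite (formPl h); ring.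
- by move=> u v; rewrite (formC h).
- by move=> u; rewrite mulr_ge0 ?(form_ge0 h).
Qed.

Lemma semi_inner_sum (V : lmodType R) (I : finType) (b : I -> V -> V -> R) :
  (forall i, semi_inner (b i)) -> semi_inner (fun u v => \sum_i b i u v).
Proof.
move=> h; split.
- move=> c u v w; rewrite mulr_sumr -big_split.
  by apply: eq_bigr => i _; rewrite (formPl (h i)).
- by move=> u v; apply: eq_bigr => i _; rewrite (formC (h i)).
- by move=> u; rewrite sumr_ge0// => i _; rewrite (form_ge0 (h i)).
Qed.

(** Linearity of [L] is asked for after pairing with [b], because corrector maps
    are linear in this sense. *)
Lemma semi_inner_pullback (U V : lmodType R) (b : V -> V -> R) (L : U -> V) :
  semi_inner b ->
  (forall c u v z, b (L (c *: u + v)) z = c * b (L u) z + b (L v) z) ->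
  semi_inner (fun u v => b (L u) (L v)).
Proof.
move=> h hL; split => [c u v w|u v|u]; first exact: hL.
  exact: (formC h).
exact: (form_ge0 h).
Qed.

(** The square of a sum is controlled by the number of its nonzero terms: this
    is [2 b(x_i, x_j) <= b(x_i, x_i) + b(x_j, x_j)] summed over the pairs of
    indices in the support. *)
Lemma form_sum_card_le (V : lmodType R) (I : finType) (b : V -> V -> R)
    (x : I -> V) (J : {set I}) : semi_inner b ->
  (forall i, i \notin J -> x i = 0) ->
  b (\sum_i x i) (\sum_i x i) <= #|J|%:R * \sum_i b (x i) (x i).
Proof.
move=> h x0.
have supp (W : zmodType) (F : I -> W) : (forall i, i \notin J -> F i = 0) ->
    \sum_i F i = \sum_(i in J) F i.
  move=> F0; rewrite (bigID (mem J))/= [X in _ + X]big1; first by rewrite addr0.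
  by move=> i; exact: F0.
rewrite [\sum_i x i]supp// [\sum_i b _ _]supp; last first.
  by move=> i /x0 ->; exact: (form0l h).
rewrite (form_suml h).
have -> : \sum_(i in J) b (x i) (\sum_(j in J) x j) =
    \sum_(i in J) \sum_(j in J) b (x i) (x j).
  apply: eq_bigr => i _; rewrite (formC h) (form_suml h).
  by apply: eq_bigr => j _; rewrite (formC h).
apply: (@le_trans _ _ (\sum_(i in J) \sum_(j in J)
    (b (x i) (x i) / 2 + b (x j) (x j) / 2))).
  apply: ler_sum => i _; apply: ler_sum => j _.
  have := form_ge0 h (x i - x j).
  rewrite (form_sqrD h) (formNr h) (formNl h) (formNr h); lra.
set s := \sum_(i in J) b (x i) (x i).
rewrite (_ : \sum_(i in J) _ = s / 2 *+ #|J| + s / 2 *+ #|J|).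
  by rewrite -mulr_natl; lra.
under eq_bigr do rewrite big_split/=.
rewrite big_split/=; congr (_ + _).
  under eq_bigr do rewrite sumr_const.
  by rewrite sumrMnl /s mulr_suml.
by rewrite sumr_const /s mulr_suml.
Qed.

End semi_inner.

Section semi_inner_projection.
Context {R : realType} (V : vectType R) (b : V -> V -> R).
Hypothesis bP : semi_inner b.
Local Notation nb := (seminorm_of b).

(** Gram--Schmidt; directions that are null for the form are skipped. *)
Lemma ex_orthogonal_projection (U : {vspace V}) (u : V) :
  exists2 p, p \in U & forall v, v \in U -> b (u - p) v = 0.
Proof.
rewrite -(span_basis (vbasisP U)); move: (tval _) => X {U}.
elim: X u => [|x X ih] u.
  exists 0; first exact: mem0v.
  by move=> v; rewrite span_nil memv0 => /eqP ->; exact: form0r.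
have [px pxX pxP] := ih x; have [pu puX puP] := ih u.
pose x' := x - px.
pose t := b (u - pu) x' / b x' x'.
exists (pu + t *: x').
  rewrite span_cons /x' scalerBr addrCA memv_add ?rpredB ?rpredZ ?memv_line//.
move=> v; rewrite span_cons => /memv_addP[_ /vlineP[c ->]] [y yX ->].
have orthX z : z \in <<X>>%VS -> b x' z = 0 by exact: pxP.
have -> : c *: x + y = c *: x' + (c *: px + y).
  by rewrite /x' scalerBr addrA subrK.
have zX : c *: px + y \in <<X>>%VS by rewrite rpredD ?rpredZ.
rewrite opprD addrA (formDr bP) !(formBl bP (u - pu)) (puP _ zX).
rewrite !(formZl bP) (orthX _ zX) mulr0 subrr addr0 !(formZr bP).
have [x0|x0] := eqVneq (b x' x') 0.
  by rewrite x0 (formC bP) (form_null bP _ x0) !mulr0 subrr.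
by rewrite /t mulrCA divfK// subrr.
Qed.

Lemma ex_best_approximation (U : {vspace V}) (u : V) :
  exists2 p, p \in U & forall v, v \in U -> nb (u - p) <= nb (u - v).
Proof.
have [p pU pP] := ex_orthogonal_projection U u; exists p => // v vU.
rewrite ler_wsqrtr// -[u - v](subrKA p) [leRHS](form_sqrD bP).
rewrite [b (u - p) (p - v)]pP ?rpredB// mulr0 addr0 lerDl; exact: form_ge0.
Qed.

End semi_inner_projection.

Section oblique_projection.
Context {R : realType} (V : lmodType R) (b : V -> V -> R).
Hypothesis bP : semi_inner b.
Local Notation nb := (seminorm_of b).
Variables (l : V -> R) (g B : R).
Hypothesis l_linear : forall c u v, l (c *: u + v) = c * l u + l v.
Hypothesis l_bound : forall u, `|l u| <= B * nb u.
Hypothesis g_gt0 : 0 < g.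

(** [P u = (l u / l w) w] is the projection onto the line of [w] along the kernel
    of [l], of norm at most [B / g].  Since [P] fixes [w], the part of [w + r]
    in the kernel is [G = r - P r], and [g |G| <= B |r|] because a projection and
    its complement have the same norm in a Hilbert space.  Concretely, with
    [r = G + t w], the vector [s G + w] with [s = t |w|^2 / |G|^2] is a multiple
    in norm of [r], while [l (s G + w) = l w]. *)
Lemma oblique_projection_bound (w r : V) : 0 < nb w -> g * nb w <= l w ->
  g * nb (w + r) <= `|l (w + r)| + B * nb r.
Proof.
move=> wp hw.
have lw : 0 < l w by apply: lt_le_trans hw; rewrite mulr_gt0.
pose G := r - (l r / l w) *: w.
pose t := l r / l w.
have lG : l G = 0.
  by rewrite /G -scaleNr addrC l_linear; field; rewrite gt_eqF.
have rE : r = G + t *: w by rewrite /G subrK.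
move: lG rE; clearbody G t => lG rE.
have key : g * nb G <= B * nb r.
  have [G0|G0] := eqVneq (nb G) 0.
    rewrite G0 mulr0; exact: le_trans (normr_ge0 _) (l_bound r).
  pose s := t * b w w / b G G.
  have bG : b G G != 0 by rewrite -sqr_seminorm_of// expf_neq0.
  have bw : b w w != 0 by rewrite -sqr_seminorm_of// expf_neq0// gt_eqF.
  have h : l (s *: G + w) = l w by rewrite l_linear lG mulr0 add0r.
  have nE : nb (s *: G + w) = nb w / nb G * nb r.
    apply/eqP; rewrite -(@eqrXn2 _ 2)// ?mulr_ge0 ?invr_ge0 ?seminorm_of_ge0//.
    rewrite 2!exprMn exprVn !sqr_seminorm_of// rE !(form_sqrD bP).
    rewrite !(formZl bP) !(formZr bP).
    apply/eqP; rewrite /s; field; exact: bG.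
  have := ler_norm (l (s *: G + w)); rewrite h => h1.
  have := l_bound (s *: G + w); rewrite h nE => h2.
  have Gp : 0 < nb G by rewrite lt_def G0 seminorm_of_ge0.
  rewrite -(ler_pM2r wp) -(ler_pM2r (_ : 0 < (nb G)^-1)) ?invr_gt0//.
  have := le_trans hw (le_trans h1 h2); congr (_ <= _).
    by field; rewrite gt_eqF.
  by field; rewrite gt_eqF.
have e : w + r = (1 + t) *: w + G.
  by rewrite rE scalerDl scale1r [G + _]addrC addrA.
have le : l (w + r) = (1 + t) * l w by rewrite e l_linear lG addr0.
rewrite le {}e.
apply: le_trans (_ : g * (`|1 + t| * nb w + nb G) <= _).
  rewrite ler_pM2l// -(seminorm_ofZ bP); exact: ler_seminorm_ofD.
rewrite mulrDr lerD// mulrCA normrM ler_wpM2l// (le_trans hw)// ler_norm//.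
Qed.

End oblique_projection.

(** * Integrals of quadratic forms of square-integrable fields *)

Section generic_integrals.
Context {R : realType} {d0 : measure_display} {T : measurableType d0}.
Variable mu : {measure set T -> \bar R}.

Lemma Rintegral_sum (I : Type) (s : seq I) (D : set T) (F : I -> T -> R) :
  measurable D -> (forall i, mu.-integrable D (EFin \o F i)) ->
  \int[mu]_(x in D) (\sum_(i <- s) F i x) = \sum_(i <- s) \int[mu]_(x in D) F i x.
Proof.
move=> mD iF; elim: s => [|i s ih].
  by rewrite big_nil /Rintegral integral0_eq// => x _; rewrite big_nil.
rewrite big_cons -ih -RintegralD//; last first.
  rewrite (_ : _ \o _ = (fun x => \sum_(j <- s) (F j x)%:E)%E).
    by apply: integrable_sum => // j _; exact: iF.
  by apply/funext => x; rewrite /= sumEFin.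
by apply: eq_Rintegral => x _; rewrite big_cons.
Qed.

Lemma ae_ge0_le_Rintegral (D : set T) (f g : T -> R) : measurable D ->
  mu.-integrable D (EFin \o f) -> mu.-integrable D (EFin \o g) ->
  (forall x, D x -> 0 <= f x) -> (forall x, D x -> 0 <= g x) ->
  {ae mu, forall x, D x -> f x <= g x} ->
  \int[mu]_(x in D) f x <= \int[mu]_(x in D) g x.
Proof.
move=> mD fi gi f0 g0 fg; apply: fine_le; try exact: integrable_fin_num.
apply: ae_ge0_le_integral => //.
- exact: measurable_int fi.
- exact: measurable_int gi.
Qed.

Lemma sum_Rintegral_disjoint_le (I : finType) (D : set T) (F : I -> set T)
    (f : T -> R) : measurable D -> (forall i, measurable (F i)) ->
  trivIset setT F -> (forall i, F i `<=` D) ->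
  mu.-integrable D (EFin \o f) -> (forall x, D x -> 0 <= f x) ->
  \sum_i \int[mu]_(x in F i) f x <= \int[mu]_(x in D) f x.
Proof.
move=> mD mF tF FD fi f0.
have fiF i : mu.-integrable (F i) (EFin \o f) by exact: integrableS (FD i) fi.
rewrite -lee_fin -sumEFin /Rintegral.
rewrite [leRHS]fineK; last exact: integrable_fin_num.
rewrite [X in (X <= _)%E](_ : _ =
    (\sum_(i <- index_enum I) \int[mu]_(x in F i) (f x)%:E)%E); last first.
  by apply: eq_bigr => i _; rewrite fineK//; exact: integrable_fin_num.
have UD : \big[setU/set0]_(i <- index_enum I) F i `<=` D.
  by move=> x; rewrite -bigcup_seq => -[i _]; exact: FD.
have mf := measurable_int _ fi.
rewrite -ge0_integral_bigsetU//; first last.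
- by move=> x /UD Dx; rewrite lee_fin f0.
- exact: measurable_funS UD mf.
- exact: sub_trivIset tF.
- exact: index_enum_uniq.
apply: ge0_subset_integral => //.
exact: bigsetU_measurable.
Qed.

Lemma ge0_integral_le_comb (D : set T) (h f g : T -> R) (a b : R) :
  measurable D -> measurable_fun D h -> measurable_fun D f -> measurable_fun D g ->
  (forall x, 0 <= h x) -> (forall x, 0 <= f x) -> (forall x, 0 <= g x) ->
  0 <= a -> 0 <= b -> (forall x, D x -> h x <= a * f x + b * g x) ->
  (\int[mu]_(x in D) (h x)%:E <=
   a%:E * \int[mu]_(x in D) (f x)%:E + b%:E * \int[mu]_(x in D) (g x)%:E)%E.
Proof.
move=> mD mh mf mg h0 f0 g0 a0 b0 hfg.
have mEf : measurable_fun D (EFin \o f) by exact/measurable_EFinP.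
have mEg : measurable_fun D (EFin \o g) by exact/measurable_EFinP.
have Ef0 x : D x -> (0 <= (f x)%:E)%E by rewrite lee_fin.
have Eg0 x : D x -> (0 <= (g x)%:E)%E by rewrite lee_fin.
rewrite -(ge0_integralZl _ mD mEf)// -(ge0_integralZl _ mD mEg)//.
rewrite -ge0_integralD//; first last.
- exact: measurable_funeM.
- by move=> x Dx; rewrite mule_ge0 ?Eg0.
- exact: measurable_funeM.
- by move=> x Dx; rewrite mule_ge0 ?Ef0.
apply: ge0_le_integral => //.
- by move=> x _; rewrite lee_fin.
- exact/measurable_EFinP.
- by apply: emeasurable_funD; exact: measurable_funeM.
Qed.

End generic_integrals.

Section pointwise.
Context {R : realType} {d : nat}.
Local Notation pt := 'rV[R]_d.

Lemma dotvE (x y : pt) : dotv x y = \sum_i x 0 i * y 0 i.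
Proof. by rewrite /dotv mxE; apply: eq_bigr => i _; rewrite mxE. Qed.

Lemma matvE (M : 'M[R]_d) (x : pt) i : matv M x 0 i = \sum_j x 0 j * M i j.
Proof. by rewrite /matv mxE; apply: eq_bigr => j _; rewrite mxE. Qed.

Lemma matv1 (x : pt) : matv 1%:M x = x.
Proof. by rewrite /matv trmx1 mulmx1. Qed.

Lemma dotvC (x y : pt) : dotv x y = dotv y x.
Proof. by rewrite !dotvE; apply: eq_bigr => i _; rewrite mulrC. Qed.

Lemma dotv_linear c (x y z : pt) :
  dotv (c *: x + y) z = c * dotv x z + dotv y z.
Proof. by rewrite /dotv mulmxDl -scalemxAl !mxE. Qed.

Lemma dotv_ge0 (x : pt) : 0 <= dotv x x.
Proof. by rewrite dotvE sumr_ge0// => i _; rewrite -expr2 sqr_ge0. Qed.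

Lemma dotvP : semi_inner (@dotv R d).
Proof. by split; [exact: dotv_linear|exact: dotvC|exact: dotv_ge0]. Qed.

Lemma dotv_eq0 (x : pt) : dotv x x = 0 -> x = 0.
Proof.
rewrite dotvE => /eqP; rewrite psumr_eq0; last first.
  by move=> i _; rewrite -expr2 sqr_ge0.
move=> /allP h; apply/rowP => i; rewrite mxE.
by have := h i (mem_index_enum i); rewrite mulf_eq0 orbb => /eqP.
Qed.

Lemma dotv_matv (M N : 'M[R]_d) (x y : pt) :
  dotv (matv M x) (matv N y) = dotv (matv (N^T *m M) x) y.
Proof. by rewrite /dotv /matv !trmx_mul !trmxK !mulmxA. Qed.

Lemma matv_form (M : 'M[R]_d) : M^T = M ->
  (forall x, 0 <= dotv x (matv M x)) ->
  semi_inner (fun x y : pt => dotv (matv M x) y).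
Proof.
move=> Ms M0; split => [c x y z|x y|x].
- by rewrite /matv mulmxDl -scalemxAl dotv_linear.
- by rewrite dotvC -{1}[y]matv1 dotv_matv mulmx1 Ms.
- by rewrite dotvC.
Qed.

(** This is positivity of the form on [x + y] and on [x - y].  It bounds all the
    integrands by squares, so that only measurability of the coefficients is
    left to check. *)
Lemma matv_form_bound (M : 'M[R]_d) (c : R) (x y : pt) : M^T = M ->
  (forall z, 0 <= dotv z (matv M z) <= c * dotv z z) ->
  `|dotv (matv M x) y| <= c * (dotv x x + dotv y y).
Proof.
move=> Ms h; have MP := matv_form Ms (fun z => proj1 (andP (h z))).
have hx := proj2 (andP (h x)); have hy := proj2 (andP (h y)).
have h1 := form_ge0 MP (x + y); have h2 := form_ge0 MP (x - y).
have hx0 := form_ge0 MP x; have hy0 := form_ge0 MP y.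
move: h1 h2; rewrite !(form_sqrD MP) (formNl MP) !(formNr MP).
rewrite dotvC in hx; rewrite dotvC in hy.
by rewrite ler_norml => h1 h2; apply/andP; split; lra.
Qed.

End pointwise.

Section fields.
Context {R : realType} {d : nat}.
Local Notation pt := 'rV[R]_d.
Local Notation leb := (lebesgue_rV d).

Lemma open_measurable_rV (U : set pt) : open U -> measurable U.
Proof. exact: sub_sigma_algebra. Qed.

Lemma continuous_measurable_rV (f : pt -> R) :
  continuous f -> measurable_fun setT f.
Proof.
move=> cf; apply: (measurability _ (RGenOpens.measurableE R)) => _ [_ [a [b ->]] <-].
rewrite setTI; apply: open_measurable_rV.
by apply: open_comp; [move=> x _; exact: cf|exact: interval_open].
Qed.

Lemma L2_measurable (D : set pt) (f : pt -> R) : measurable D ->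
  L2 D f -> measurable_fun D f.
Proof.
move=> mD /sub_Lfun_mfun; rewrite inE /= => mf.
exact/(measurable_restrictT _ mD).
Qed.

Lemma L2_integrable_sqr (D : set pt) (f : pt -> R) : measurable D ->
  L2 D f -> leb.-integrable D (EFin \o (fun x => f x ^+ 2)).
Proof.
move=> mD /Lfun2_integrable_sqr h; apply/(integrable_mkcond _ mD).
move: h; congr (_.-integrable _ _); apply/funext => x /=.
by rewrite /patch; case: ifP => //= _; rewrite expr0n.
Qed.

(** Measurable symmetric coefficients with values between 0 and [c] as
    quadratic forms. *)
Definition bounded_field (D : set pt) (c : R) (A : pt -> 'M[R]_d) : Prop :=
  [/\ forall i j, measurable_fun D (fun x => A x i j),
      forall x, D x -> (A x)^T = A x
    & forall x, D x -> forall xi,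
        0 <= dotv xi (matv (A x) xi) <= c * dotv xi xi].

Lemma measurable_dotv (D : set pt) (G K : pt -> pt) :
  (forall i, measurable_fun D (fun x => G x 0 i)) ->
  (forall i, measurable_fun D (fun x => K x 0 i)) ->
  measurable_fun D (fun x => dotv (G x) (K x)).
Proof.
move=> mG mK; under eq_fun do rewrite dotvE.
by apply: measurable_sum => i; exact: measurable_funM.
Qed.

Lemma integrable_field (D : set pt) c A (G K : pt -> pt) : measurable D ->
  bounded_field D c A ->
  (forall i, L2 D (fun x => G x 0 i)) -> (forall i, L2 D (fun x => K x 0 i)) ->
  leb.-integrable D (EFin \o (fun x => dotv (matv (A x) (G x)) (K x))).
Proof.
move=> mD [mA sA bA] LG LK.
have mG i := L2_measurable mD (LG i); have mK i := L2_measurable mD (LK i).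
have iS (F : pt -> pt) : (forall i, L2 D (fun x => F x 0 i)) ->
    leb.-integrable D (EFin \o (fun x => dotv (F x) (F x))).
  move=> LF; rewrite (_ : _ \o _ = (fun x => \sum_i (F x 0 i ^+ 2)%:E)%E).
    by apply: integrable_sum => // i _; exact: L2_integrable_sqr.
  by apply/funext => x; rewrite /= dotvE sumEFin.
apply: (@le_integrable _ _ _ _ _ mD _
  (EFin \o (fun x => c * (dotv (G x) (G x) + dotv (K x) (K x))))).
- apply/measurable_EFinP; apply: measurable_dotv => // i.
  under eq_fun do rewrite matvE.
  by apply: measurable_sum => j; exact: measurable_funM.
- move=> x Dx; rewrite /= lee_fin (le_trans (matv_form_bound _ _ (sA x Dx) (bA x Dx)))//.
  exact: ler_norm.
- rewrite (_ : _ \o _ = (fun x => c%:E * ((dotv (G x) (G x))%:E + (dotv (K x) (K x))%:E))%E).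
    by apply: integrableZl => //; apply: integrableD => //; exact: iS.
  by apply/funext => x; rewrite /= EFinM EFinD.
Qed.

End fields.

(** * The energy forms on the finite element space *)

Definition dirichlet {R : realType} {d : nat} {Omega : set 'rV[R]_d}
    {Vh : vectType R} (S : H10_subspace Omega Vh) (v w : Vh) : R :=
  \int[lebesgue_rV d]_(x in Omega) dotv (fgrad S v x) (fgrad S w x).

Section forms_on_Vh.
Context {R : realType} {d : nat} {Omega : set 'rV[R]_d} {Vh : vectType R}.
Variable S : H10_subspace Omega Vh.
Hypothesis oO : open Omega.
Local Notation pt := 'rV[R]_d.
Local Notation leb := (lebesgue_rV d).

Let mO : measurable Omega. Proof. exact: open_measurable_rV. Qed.

Lemma fgradD v w x : fgrad S (v + w) x = fgrad S v x + fgrad S w x.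
Proof. by have := fgrad_linear S 1 v w x; rewrite !scale1r. Qed.

Lemma fgrad0 x : fgrad S 0 x = 0.
Proof. by apply: (@addrI _ (fgrad S 0 x)); rewrite -fgradD !addr0. Qed.

Lemma fgrad_sum (I : Type) (s : seq I) (F : I -> Vh) x :
  fgrad S (\sum_(i <- s) F i) x = \sum_(i <- s) fgrad S (F i) x.
Proof. by elim/big_rec2: _ => [|i y z _ <-]; rewrite ?fgrad0 ?fgradD. Qed.

Lemma L2_fgrad v i : L2 Omega (fun x => fgrad S v x 0 i).
Proof. by have [_ h _] := fval_H1 S v; exact: h. Qed.

Lemma integrable_aform c A (D : set pt) v w : measurable D -> D `<=` Omega ->
  bounded_field Omega c A ->
  leb.-integrable D
    (EFin \o (fun x => dotv (matv (A x) (fgrad S v x)) (fgrad S w x))).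
Proof.
move=> mD DO bA; apply: (integrableS mO mD DO).
by apply: integrable_field bA _ _ => //; exact: L2_fgrad.
Qed.

Lemma aform_onP c A (D : set pt) : measurable D -> D `<=` Omega ->
  bounded_field Omega c A -> semi_inner (aform_on S A D).
Proof.
move=> mD DO bA; have [mA sA pA] := bA.
have AP x : D x -> semi_inner (fun y z : pt => dotv (matv (A x) y) z).
  move=> /DO Dx; apply: matv_form; first exact: sA.
  by move=> z; case/andP: (pA x Dx z).
have iA v w := integrable_aform v w mD DO bA.
split => [k u v w|u v|u].
- rewrite /aform_on -RintegralZl// -RintegralD//; last first.
    rewrite (_ : _ \o _ = (fun x => k%:E *
      (EFin \o (fun x => dotv (matv (A x) (fgrad S u x)) (fgrad S w x))) x)%E).
      by apply: integrableZl.
    by apply/funext => x; rewrite /= EFinM.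
  apply: eq_Rintegral => x; rewrite inE => Dx.
  by rewrite fgrad_linear (formPl (AP x Dx)).
- by apply: eq_Rintegral => x; rewrite inE => Dx; rewrite (formC (AP x Dx)).
- by apply: Rintegral_ge0 => x Dx; exact: (form_ge0 (AP x Dx)).
Qed.

Lemma dirichletE : dirichlet S = aform_on S (fun=> 1%:M) Omega.
Proof.
by apply/funext => v; apply/funext => w; apply: eq_Rintegral => x _; rewrite matv1.
Qed.

Lemma id_bounded_field : bounded_field Omega 1 (fun=> 1%:M : 'M[R]_d).
Proof.
split => [i j|x _|x _ xi]; [exact: measurable_cst|exact: trmx1|].
by rewrite matv1 mul1r lexx dotv_ge0.
Qed.

Lemma dirichletP : semi_inner (dirichlet S).
Proof. by rewrite dirichletE; apply: aform_onP id_bounded_field. Qed.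

Section elliptic.
Variables (alpha beta : R) (A Ahalf : pt -> 'M[R]_d).
Hypothesis alpha_ge0 : 0 <= alpha.
Hypothesis hA : elliptic_field Omega alpha beta A.

Lemma elliptic_bounded_field : bounded_field Omega beta A.
Proof.
have [LA sA bA] := hA; split => // [i j|x Ox xi].
  have := LA i j => /sub_Lfun_mfun; rewrite inE /= => mf.
  exact/(measurable_restrictT _ mO).
have /andP[h1 ->] := bA x Ox xi; rewrite andbT (le_trans _ h1)//.
by rewrite mulr_ge0// dotv_ge0.
Qed.

Lemma aformP : semi_inner (aform S A).
Proof. exact: aform_onP elliptic_bounded_field. Qed.

Lemma aform_bounds v : alpha * dirichlet S v v <= aform S A v v <= beta * dirichlet S v v.
Proof.
have [_ _ bA] := hA.
have i1 : leb.-integrable Omega (EFin \o (fun x => dotv (fgrad S v x) (fgrad S v x))).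
  have := integrable_aform v v mO (@subset_refl _ Omega) id_bounded_field.
  by under eq_fun do rewrite matv1.
have iA := integrable_aform v v mO (@subset_refl _ Omega) elliptic_bounded_field.
have iZ (c : R) : leb.-integrable Omega
    (EFin \o (fun x => c * dotv (fgrad S v x) (fgrad S v x))).
  rewrite (_ : _ \o _ = (fun x => c%:E *
    (EFin \o (fun x => dotv (fgrad S v x) (fgrad S v x))) x)%E).
    exact: integrableZl.
  by apply/funext => x; rewrite /= EFinM.
rewrite /dirichlet -!RintegralZl//; apply/andP; split.
- apply: le_Rintegral => // x Ox; rewrite [leRHS]dotvC.
  by case/andP: (bA x Ox (fgrad S v x)).
- apply: le_Rintegral => // x Ox; rewrite [leLHS]dotvC.
  by case/andP: (bA x Ox (fgrad S v x)).
Qed.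

Lemma norma_aform v : (forall x, Omega x -> is_sqrt (Ahalf x) (A x)) ->
  norma S Ahalf v = seminorm_of (aform S A) v.
Proof.
move=> hs; rewrite /norma /seminorm_of; congr Num.sqrt.
apply: eq_Rintegral => x; rewrite inE => Ox; have [sB _ B2] := hs x Ox.
by rewrite dotv_matv sB B2.
Qed.

Lemma sum_aform_on_le (I : finType) (T : I -> set pt) v :
  (forall i, measurable (T i)) -> trivIset setT T -> (forall i, T i `<=` Omega) ->
  \sum_i aform_on S A (T i) v v <= aform S A v v.
Proof.
move=> mT tT TO; apply: sum_Rintegral_disjoint_le => //.
  exact: integrable_aform elliptic_bounded_field.
move=> x Ox; rewrite dotvC; have [_ _ pA] := elliptic_bounded_field.
by case/andP: (pA x Ox (fgrad S v x)).
Qed.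

(** Almost every point sees at most [C] of the fields, so the pointwise bound
    for the square of a sum can be integrated. *)
Lemma aform_overlap (I : finType) (U : I -> set pt) (C : nat) (w : I -> Vh) :
  (forall x, Omega x -> (#|[set i | `[< U i x >]]%SET| <= C)%N) ->
  (forall i, {ae leb, forall x, Omega x -> ~ U i x -> fgrad S (w i) x = 0}) ->
  aform S A (\sum_i w i) (\sum_i w i) <= C%:R * \sum_i aform S A (w i) (w i).
Proof.
move=> hC hU; have [mA sA pA] := elliptic_bounded_field.
have AP x : Omega x -> semi_inner (fun y z : pt => dotv (matv (A x) y) z).
  move=> Ox; apply: matv_form; first exact: sA.
  by move=> z; case/andP: (pA x Ox z).
have iA v := integrable_aform v v mO (@subset_refl _ Omega) elliptic_bounded_field.
pose q i x := dotv (matv (A x) (fgrad S (w i) x)) (fgrad S (w i) x).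
have iq : leb.-integrable Omega (EFin \o (fun x => \sum_i q i x)).
  rewrite (_ : _ \o _ = (fun x => \sum_i (q i x)%:E)%E).
    by apply: integrable_sum => // i _; exact: iA.
  by apply/funext => x; rewrite /= sumEFin.
have q0 i x : Omega x -> 0 <= q i x by move=> Ox; exact: (form_ge0 (AP x Ox)).
rewrite /aform /aform_on -Rintegral_sum// -RintegralZl//.
apply: ae_ge0_le_Rintegral => //.
- rewrite (_ : _ \o _ = (fun x => C%:R%:E * (\sum_i q i x)%R%:E)%E).
    exact: integrableZl.
  by apply/funext => x; rewrite /= EFinM.
- by move=> x Ox; exact: (form_ge0 (AP x Ox)).
- by move=> x Ox; rewrite mulr_ge0// sumr_ge0// => i _; exact: q0.
have : {ae leb, forall x, forall i, Omega x -> ~ U i x -> fgrad S (w i) x = 0}.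
  exact: filter_forall.
apply: filterS => x hx Ox; rewrite fgrad_sum.
apply: (le_trans (form_sum_card_le (J := [set i | `[< U i x >]]%SET) (AP x Ox) _)).
  by move=> i; rewrite inE => /asboolP h; exact: hx.
rewrite ler_wpM2r ?ler_nat ?hC// sumr_ge0// => i _; exact: q0.
Qed.

End elliptic.
End forms_on_Vh.

(** * Closures of test functions and the fine-scale spaces *)

Section H10_facts.
Context {R : realType} {d : nat}.
Local Notation pt := 'rV[R]_d.
Local Notation leb := (lebesgue_rV d).
Implicit Types (phi psi u v : pt -> R) (G K : pt -> pt) (Omega U D : set pt)
  (s : seq 'I_d).

Lemma continuous_linear_comb (T : topologicalType) (f g : T -> R) c :
  continuous f -> continuous g -> continuous (fun x => c * f x + g x).
Proof.
move=> cf cg x.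
apply: (@cvgD _ _ _ _ _ (fun x => c * f x) g _ _ _ (cg x)).
apply: (@cvgM _ _ _ _ (cst c) f _ _ _ (cf x)).
exact: cvg_cst.
Qed.

Lemma foldr_partial_linear c phi psi s : smooth phi -> smooth psi ->
  foldr (@partial R d) (fun x => c * phi x + psi x) s =
  (fun x => c * foldr (@partial R d) phi s x + foldr (@partial R d) psi s x).
Proof.
move=> sphi spsi; elim: s => [//|i s ih] /=; rewrite {}ih.
have [_ dphi] := sphi s; have [_ dpsi] := spsi s.
apply/funext => x; rewrite {1}/partial.
rewrite (deriveD (derivableZ (k := c) (dphi i x)) (dpsi i x)).
by rewrite deriveZ.
Qed.

Lemma smooth_linear c phi psi : smooth phi -> smooth psi ->
  smooth (fun x => c * phi x + psi x).
Proof.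
move=> sphi spsi s /=; rewrite foldr_partial_linear//.
have [cphi dphi] := sphi s; have [cpsi dpsi] := spsi s; split.
  exact: continuous_linear_comb.
by move=> i x; exact: (derivableD (derivableZ (k := c) (dphi i x)) (dpsi i x)).
Qed.

Lemma gradient_linear c phi psi x : smooth phi -> smooth psi ->
  gradient (fun x => c * phi x + psi x) x = c *: gradient phi x + gradient psi x.
Proof.
move=> sphi spsi; apply/rowP => i; rewrite !mxE.
exact: (congr1 (@^~ x) (foldr_partial_linear c [:: i] sphi spsi)).
Qed.

Lemma test_function_linear c U phi psi : test_function U phi ->
  test_function U psi -> test_function U (fun x => c * phi x + psi x).
Proof.
move=> [sphi kphi Uphi] [spsi kpsi Upsi].
have sub : closure [set x | c * phi x + psi x != 0] `<=`
    closure [set x | phi x != 0] `|` closure [set x | psi x != 0].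
  rewrite -closureU; apply: closureS => x /= h.
  have [p0|p0] := eqVneq (phi x) 0; last by left.
  by right; move: h; rewrite p0 mulr0 add0r.
split; first exact: smooth_linear.
  by apply: subclosed_compact sub; [exact: closed_closure|exact: compactU].
by move=> x /sub[/Uphi|/Upsi].
Qed.

Lemma smooth_measurable phi : smooth phi -> measurable_fun setT phi.
Proof. by move=> h; have [c _] := h [::]; exact: continuous_measurable_rV. Qed.

Lemma smooth_measurable_partial phi i :
  smooth phi -> measurable_fun setT (partial i phi).
Proof. by move=> h; have [c _] := h [:: i]; exact: continuous_measurable_rV. Qed.

Lemma gradient_off_support phi x :
  ~ closure [set y | phi y != 0] x -> phi x = 0 /\ gradient phi x = 0.
Proof.
move=> nx.
have nz : \forall y \near x, phi y = 0.
  have oC : open (~` closure [set y | phi y != 0]).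
    exact/closed_openC/closed_closure.
  have : nbhs x (~` closure [set y | phi y != 0]) by exact: open_nbhs_nbhs.
  apply: filterS => y ny; apply/eqP; apply: contrapT => /negP py; apply: ny.
  exact: subset_closure.
split; first exact: (nbhs_singleton nz).
apply/rowP => i; rewrite !mxE /partial.
by rewrite (@near_eq_derive _ _ _ _ (cst 0))// derive_cst.
Qed.

(** The integrand of the squared [H^1] distance in the definition of [H10]. *)
Definition H1_gap (u : pt -> R) (G : pt -> pt) phi x : R :=
  (u x - phi x) ^+ 2 + dotv (G x - gradient phi x) (G x - gradient phi x).

Lemma H1_gap_ge0 u G phi x : 0 <= H1_gap u G phi x.
Proof. by rewrite addr_ge0 ?sqr_ge0 ?dotv_ge0. Qed.

Lemma measurable_H1_gap D u G phi :
  measurable_fun D u -> (forall i, measurable_fun D (fun x => G x 0 i)) ->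
  smooth phi -> measurable_fun D (H1_gap u G phi).
Proof.
move=> mu mG sphi; apply: measurable_funD.
  apply: measurable_funX; apply: measurable_funB => //.
  by apply: measurable_funTS; exact: smooth_measurable.
have mK i : measurable_fun D (fun x => (G x - gradient phi x) 0 i).
  under eq_fun do rewrite !mxE.
  apply: measurable_funB => //.
  by apply: measurable_funTS; exact: smooth_measurable_partial.
exact: measurable_dotv.
Qed.

Lemma H1_gap_linear c u v G K phi psi x : smooth phi -> smooth psi ->
  H1_gap (fun y => c * u y + v y) (fun y => c *: G y + K y)
    (fun y => c * phi y + psi y) x <=
  2 * c ^+ 2 * H1_gap u G phi x + 2 * H1_gap v K psi x.
Proof.
move=> sphi spsi; rewrite /H1_gap gradient_linear//.
set a := u x - phi x; set b := v x - psi x.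
set y := G x - gradient phi x; set z := K x - gradient psi x.
rewrite (_ : c * u x + v x - (c * phi x + psi x) = c * a + b); last first.
  by rewrite /a /b; ring.
rewrite (_ : c *: G x + K x - (c *: gradient phi x + gradient psi x) =
    c *: y + z); last first.
  by rewrite /y /z scalerBr opprD addrACA.
clearbody a b y z; have h1 : 0 <= (c * a - b) ^+ 2 by exact: sqr_ge0.
have := dotv_ge0 (c *: y - z).
rewrite !(form_sqrD dotvP) !(formNl dotvP) !(formNr dotvP).
rewrite !(formZl dotvP) !(formZr dotvP); lra.
Qed.

Lemma H10_linear Omega U c u v G K : measurable Omega ->
  measurable_fun Omega u -> (forall i, measurable_fun Omega (fun x => G x 0 i)) ->
  measurable_fun Omega v -> (forall i, measurable_fun Omega (fun x => K x 0 i)) ->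
  H10 Omega U u G -> H10 Omega U v K ->
  H10 Omega U (fun x => c * u x + v x) (fun x => c *: G x + K x).
Proof.
move=> mO mu mG mv mK hu hv e e0.
(* [phi] enters with the factor [2 c^2] and [psi] with the factor 2; the 1 covers
   [c = 0]. *)
have c0 : 0 < 4 * (c ^+ 2 + 1) by rewrite mulr_gt0// ltr_wpDl// sqr_ge0.
have [phi tphi hphi] := hu _ (divr_gt0 e0 c0).
have [psi tpsi hpsi] := hv (e / 4) (divr_gt0 e0 (ltr0n _ 4)).
have [[sphi _ _] [spsi _ _]] := (tphi, tpsi).
exists (fun x => c * phi x + psi x); first exact: test_function_linear.
have c2 : 0 <= 2 * c ^+ 2 by rewrite mulr_ge0// sqr_ge0.
have := @ge0_integral_le_comb _ _ _ leb Omega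
  (H1_gap (fun x => c * u x + v x) (fun x => c *: G x + K x)
    (fun x => c * phi x + psi x)) (H1_gap u G phi) (H1_gap v K psi)
  (2 * c ^+ 2) 2 mO.
move=> /(_ _ _ _ _ _ _ c2 (ler0n _ 2)) hle.
apply: le_lt_trans (hle _ _ _ _ _ _ _) _ => {hle}; try exact: H1_gap_ge0.
- apply: measurable_H1_gap; last exact: smooth_linear.
    by apply: measurable_funD => //; exact: measurable_funM.
  move=> i; under eq_fun do rewrite !mxE.
  by apply: measurable_funD => //; exact: measurable_funM.
- exact: measurable_H1_gap.
- exact: measurable_H1_gap.
- by move=> x _; exact: H1_gap_linear.
apply: (@le_lt_trans _ _
  ((2 * c ^+ 2)%:E * (e / (4 * (c ^+ 2 + 1)))%:E +
   2%:E * \int[leb]_(x in Omega) (H1_gap v K psi x)%:E))%E.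
  by rewrite leeD2r// lee_wpmul2l ?lee_fin// ltW.
apply: (@lt_le_trans _ _
  ((2 * c ^+ 2)%:E * (e / (4 * (c ^+ 2 + 1)))%:E + 2%:E * (e / 4)%:E))%E.
  by rewrite lteD2lE ?lte_pmul2l.
rewrite -!EFinM -EFinD lee_fin.
have -> : 2 * c ^+ 2 * (e / (4 * (c ^+ 2 + 1))) + 2 * (e / 4) =
    e - e / (2 * (c ^+ 2 + 1)).
  by field; rewrite gt_eqF// ltr_wpDl// sqr_ge0.
by rewrite gerBl divr_ge0 ?ltW// mulr_gt0// ltr_wpDl// sqr_ge0.
Qed.

(** The approximating test functions vanish off [U] together with their
    gradients, hence so does their limit. *)
Lemma H10_gradient_off Omega U u G : measurable Omega -> measurable U ->
  measurable_fun Omega u -> (forall i, measurable_fun Omega (fun x => G x 0 i)) ->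
  H10 Omega U u G -> {ae leb, forall x, Omega x -> ~ U x -> G x = 0}.
Proof.
move=> mO mU mu mG hu.
pose D := Omega `\` U; have mD : measurable D by exact: measurableD.
have DO : D `<=` Omega by move=> x [].
have mGG : measurable_fun D (fun x => (dotv (G x) (G x))%:E).
  apply/measurable_EFinP; apply: measurable_dotv => i.
  - exact: measurable_funS (mG i).
  - exact: measurable_funS (mG i).
have G0 : (\int[leb]_(x in D) (dotv (G x) (G x))%:E = 0)%E.
  apply/le_anti/andP; split; last first.
    by apply: integral_ge0 => x _; rewrite lee_fin dotv_ge0.
  apply/lee_addgt0Pr => e e0; rewrite add0e.
  have [phi [sphi kphi Uphi] hphi] := hu _ e0.
  apply: le_trans (ltW hphi).
  have mgap : measurable_fun Omega (fun x => (H1_gap u G phi x)%:E).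
    by apply/measurable_EFinP; exact: measurable_H1_gap.
  apply: (@le_trans _ _ (\int[leb]_(x in D) (H1_gap u G phi x)%:E)%E).
    apply: ge0_le_integral => //.
    - by move=> x _; rewrite lee_fin dotv_ge0.
    - exact: measurable_funS mgap.
    move=> x [Ox nUx]; have [_ g0] : phi x = 0 /\ gradient phi x = 0.
      by apply: gradient_off_support => /Uphi.
    by rewrite lee_fin /H1_gap g0 subr0 lerDr sqr_ge0.
  apply: ge0_subset_integral => // x _; rewrite lee_fin; exact: H1_gap_ge0.
have : (\int[leb]_(x in D) `|(dotv (G x) (G x))%:E| = 0)%E.
  rewrite -[RHS]G0; apply: eq_integral => x _.
  by rewrite gee0_abs// lee_fin dotv_ge0.
move=> /(ae_eq_integral_abs _ mD mGG); apply: filterS => x h Ox nUx.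
by apply: dotv_eq0; have [] := h (conj Ox nUx).
Qed.

Lemma patch_measurable N (T : 'I_N -> set pt) k (omega : set pt) :
  open omega -> measurable (Defs.patch T k omega).
Proof.
case: k => [|k] oo; first exact: open_measurable_rV.
apply: open_measurable_rV; exact: open_interior.
Qed.

Lemma P1_linear Omega N (T : 'I_N -> set pt) c f g :
  P1 Omega T f -> P1 Omega T g -> P1 Omega T (fun x => c * f x + g x).
Proof.
move=> [cf af] [cg ag]; split.
  exact: (@continuous_linear_comb (subspace (closure Omega))).
move=> i; have [a [v hv]] := af i; have [b [w hw]] := ag i.
exists (c * a + b), (c *: v + w) => x Tx.
by rewrite (hv _ Tx) (hw _ Tx) dotv_linear; ring.
Qed.

Lemma ovl_count_le Omega N (T : 'I_N -> set pt) k x : Omega x ->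
  (ovl_count T k x <= ovl_const Omega T k)%N.
Proof.
move=> Ox; have h : (ovl_count T k x < N.+1)%N.
  by rewrite ltnS -[X in (_ <= X)%N](card_ord N) max_card.
rewrite /ovl_const (bigD1 (Ordinal h))/=; first exact: leq_maxl.
by apply/asboolP; exists x.
Qed.

End H10_facts.

Section spaces.
Context {R : realType} {d N : nat} {Omega : set 'rV[R]_d} {Vh : vectType R}.
Variables (S : H10_subspace Omega Vh) (TH : 'I_N -> set 'rV[R]_d) (k : nat)
  (IH : {linear Vh -> Vh}).
Hypothesis oO : open Omega.

Lemma VH_linear c u v : VH S TH u -> VH S TH v -> VH S TH (c *: u + v).
Proof.
move=> [p Pp up] [q Pq vq].
exists (fun x => c * p x + q x); first exact: P1_linear.
move: up vq; rewrite /ae_eq_on => up vq; apply: filterS2 up vq => x hp hq Ox.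
by rewrite fval_linear hp// hq.
Qed.

Lemma fval_measurable v : measurable_fun Omega (fval S v).
Proof.
by have [h _ _] := fval_H1 S v; apply: L2_measurable h; exact: open_measurable_rV.
Qed.

Lemma fgrad_measurable v i : measurable_fun Omega (fun x => fgrad S v x 0 i).
Proof.
by have [_ h _] := fval_H1 S v; apply: L2_measurable (h i); exact: open_measurable_rV.
Qed.

Lemma VfT_linear T c u v : VfT S TH k IH T u -> VfT S TH k IH T v ->
  VfT S TH k IH T (c *: u + v).
Proof.
move=> [iu hu] [iv hv]; split; first by rewrite linearP iu iv scaler0 addr0.
have := H10_linear c (open_measurable_rV oO) (fval_measurable u)
  (fgrad_measurable u) (fval_measurable v) (fgrad_measurable v) hu hv.
congr H10; apply/funext => x; rewrite ?fval_linear ?fgrad_linear//.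
Qed.

End spaces.

(** * Two-scale stability and residual minimization *)

(** If [E] is unbounded its supremum is 0 by convention. *)
Lemma sup_sym_ge0 (R : realType) (E : set R) : (exists2 x, E x & E (- x)) -> 0 <= sup E.
Proof.
move=> [x Ex ENx]; have [hE|/sup_out ->//] := pselect (has_sup E).
have [x0|x0] := leP 0 x; first exact: le_trans x0 (ub_le_sup (proj2 hE) Ex).
by apply: le_trans (ub_le_sup (proj2 hE) ENx); rewrite oppr_ge0 ltW.
Qed.

Section two_scale.
Context {R : realType} {d N : nat} {Omega : set 'rV[R]_d} {Vh : vectType R}.
Variables (S : H10_subspace Omega Vh) (TH : 'I_N -> set 'rV[R]_d) (k : nat)
  (IH : {linear Vh -> Vh}) (A Ahalf : 'rV[R]_d -> 'M[R]_d) (f : 'rV[R]_d -> R)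
  (Q : 'I_N -> Vh -> Vh).
Variables (alpha beta kappa gamma rho CI : R) (C : nat).

Local Notation VH := (VH S TH).
Local Notation W := (VfT S TH k IH).
Local Notation a := (aform S A).
Local Notation aT T := (aform_on S A (TH T)).
Local Notation i1 := (dirichlet S).
Local Notation na := (seminorm_of a).
Local Notation n1 := (seminorm_of i1).
Local Notation two_scale := (Vh * {ffun 'I_N -> Vh})%type.
Local Notation B := (BB S TH A rho).
Local Notation nnorma := (nnorma S Ahalf Q rho).
Local Notation nnorm1 := (@nnorm1 R d N Omega Vh S).
Local Notation VV := (VV S TH k IH).
Local Notation Qs := (Qsum Q).

(* From here on the integrals are seen only through these properties of the
   forms and of the spaces. *)
Hypothesis aP : semi_inner a.
Hypothesis i1P : semi_inner i1.
Hypothesis aTP : forall T, semi_inner (aT T).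
Hypothesis normaE : forall v, norma S Ahalf v = na v.
Hypothesis a_lower : forall v, alpha * i1 v v <= a v v.
Hypothesis a_upper : forall v, a v v <= beta * i1 v v.
Hypothesis aT_sum : forall v, \sum_T aT T v v <= a v v.
Hypothesis VH_comb : forall c u v, VH u -> VH v -> VH (c *: u + v).
Hypothesis W_comb : forall T c u v, W T u -> W T v -> W T (c *: u + v).
Hypothesis overlap : forall w : 'I_N -> Vh, (forall T, W T (w T)) ->
  a (\sum_T w T) (\sum_T w T) <= C%:R * \sum_T a (w T) (w T).
Hypothesis QP : is_corrector S TH k IH A Q.

Hypothesis alpha_gt0 : 0 < alpha.
Hypothesis le_alpha_beta : alpha <= beta.
Hypothesis kappaE : kappa = beta / alpha.
Hypothesis rhoE : rho = C%:R * kappa.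

(** ** Correctors *)

Let beta_gt0 : 0 < beta. Proof. exact: lt_le_trans le_alpha_beta. Qed.
Let kappa_ge1 : 1 <= kappa. Proof. by rewrite kappaE ler_pdivlMr// mul1r. Qed.
Let rho_ge0 : 0 <= rho.
Proof. by rewrite rhoE mulr_ge0// (le_trans ler01). Qed.

Let alpha_rho : alpha * rho = beta * C%:R.
Proof. by rewrite rhoE kappaE; field; rewrite gt_eqF. Qed.

Lemma W0 T : W T 0.
Proof.
by have [h _] := QP T 0; have := W_comb (-1) h h; rewrite scaleN1r addNr.
Qed.

Lemma W_opp T u : W T u -> W T (- u).
Proof. by move=> h; have := W_comb (-1) h (W0 T); rewrite scaleN1r addr0. Qed.

Lemma W_sub T u v : W T u -> W T v -> W T (u - v).
Proof. by move=> h1 h2; have := W_comb (-1) h2 h1; rewrite scaleN1r addrC. Qed.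

Lemma corrector_in T v : W T (Q T v). Proof. by have [] := QP T v. Qed.

Lemma correctorE T v w : W T w -> a (Q T v) w = aT T v w.
Proof. by have [_ h] := QP T v; exact: h. Qed.

(** The Galerkin equations force [Q T (c *: u + v)] and [c *: Q T u + Q T v] to
    differ by a vector of zero energy, which forms vanishing on such vectors
    ignore. *)
Lemma corrector_linear (b : Vh -> Vh -> R) : semi_inner b ->
  (forall v, a v v = 0 -> b v v = 0) ->
  forall T c u v z, b (Q T (c *: u + v)) z = c * b (Q T u) z + b (Q T v) z.
Proof.
move=> bP ab T c u v z.
set y := c *: Q T u + Q T v.
have yW : W T y by apply: W_comb; exact: corrector_in.
have dW : W T (Q T (c *: u + v) - y) by exact: W_sub (corrector_in _ _) yW.
have a0 : a (Q T (c *: u + v) - y) (Q T (c *: u + v) - y) = 0.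
  rewrite (formBl aP) (formPl aP) !correctorE// (formPl (aTP T)); ring.
have := form_null bP z (ab _ a0); rewrite (formBl bP) (formPl bP) => /eqP.
by rewrite subr_eq0 => /eqP.
Qed.

Lemma i1_null v : a v v = 0 -> i1 v v = 0.
Proof.
move=> v0; have := a_lower v; rewrite v0 pmulr_rle0// => h.
by apply/le_anti/andP; split => //; exact: (form_ge0 i1P).
Qed.

Lemma a_corrector_linear T c u v z :
  a (Q T (c *: u + v)) z = c * a (Q T u) z + a (Q T v) z.
Proof. exact: corrector_linear. Qed.

(** Testing the corrector equation with the corrector itself: each corrector
    only sees the energy of its own coarse element. *)
Lemma sum_corrector_le v : \sum_T a (Q T v) (Q T v) <= a v v.
Proof.
apply: (le_trans _ (aT_sum v)); apply: ler_sum => T _.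
have h w : aT T w w <= a w w.
  apply: le_trans (aT_sum w).
  rewrite (bigD1 T)//= lerDl sumr_ge0// => i _; exact: (form_ge0 (aTP i)).
have := form_ge0 (aTP T) (v - Q T v).
rewrite (form_sqrD (aTP T)) !(formNr (aTP T)) (formNl (aTP T)).
rewrite -(correctorE _ (corrector_in T v)).
have := h (Q T v); lra.
Qed.

(** ** The two-scale inner products *)

(** The defects of the exact solution have zero energy. *)
Definition defect (uu : two_scale) T : Vh := Q T uu.1 - uu.2 T.
(** The function that [uu] stands for: fine-scale parts enter with the sign of
    the correctors. *)
Definition glue (uu : two_scale) : Vh := uu.1 - \sum_T uu.2 T.
(** Its seminorm is the two-scale energy norm [nnorma]. *)
Definition energy_form (uu vv : two_scale) : R :=
  a (glue uu) (glue vv) + rho * \sum_T a (defect uu T) (defect vv T).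
(** Its seminorm, at the difference with the exact solution, is [err1]. *)
Definition h1_form (uu vv : two_scale) : R :=
  i1 uu.1 vv.1 + rho * \sum_T i1 (defect uu T) (defect vv T).
Definition product_form (b : Vh -> Vh -> R) (uu vv : two_scale) : R :=
  b uu.1 vv.1 + \sum_T b (uu.2 T) (vv.2 T).

Lemma product_formP b : semi_inner b -> semi_inner (product_form b).
Proof.
move=> bP; apply: semi_innerD.
  by apply: (semi_inner_pullback bP) => c u v z; exact: (formPl bP).
apply: semi_inner_sum => T; apply: (semi_inner_pullback bP) => c u v z /=.
by rewrite !ffunE (formPl bP).
Qed.

Lemma defect_linear b : semi_inner b ->
  (forall v, a v v = 0 -> b v v = 0) ->
  forall T c u v z,
  b (defect (c *: u + v) T) z = c * b (defect u T) z + b (defect v T) z.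
Proof.
move=> bP ab T c u v z; rewrite /defect /= !(formBl bP) (corrector_linear bP)//.
by rewrite !ffunE (formPl bP); ring.
Qed.

Lemma glue_linear c u v : glue (c *: u + v) = c *: glue u + glue v.
Proof.
rewrite /glue /=; under eq_bigr do rewrite !ffunE.
by rewrite big_split/= -scaler_sumr opprD addrACA scalerBr.
Qed.

Lemma energy_formP : semi_inner energy_form.
Proof.
apply: semi_innerD.
  by apply: (semi_inner_pullback aP) => c u v z; rewrite glue_linear (formPl aP).
apply: semi_innerZ => //; apply: semi_inner_sum => T.
apply: (semi_inner_pullback (L := defect ^~ T) aP) => c u v z; exact: (defect_linear aP).
Qed.

Lemma h1_formP : semi_inner h1_form.
Proof.
apply: semi_innerD.
  by apply: (semi_inner_pullback i1P) => c u v z; exact: (formPl i1P).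
apply: semi_innerZ => //; apply: semi_inner_sum => T.
apply: (semi_inner_pullback i1P) => c u v z; apply: defect_linear => //.
exact: i1_null.
Qed.

Lemma norm1E v : norm1 S v = n1 v. Proof. by []. Qed.

Lemma norm1_sqr v : norm1 S v ^+ 2 = i1 v v.
Proof. by rewrite sqr_sqrtr// (form_ge0 i1P). Qed.

Lemma nnormaE uu : nnorma uu = seminorm_of energy_form uu.
Proof.
rewrite /nnorma /seminorm_of /energy_form; congr (Num.sqrt (_ + _ * _)).
  by rewrite normaE (sqr_seminorm_of aP).
by apply: eq_bigr => T _; rewrite normaE (sqr_seminorm_of aP).
Qed.

Lemma nnorm1E uu : nnorm1 uu = seminorm_of (product_form i1) uu.
Proof.
rewrite /nnorm1 /seminorm_of /product_form norm1_sqr; congr (Num.sqrt (_ + _)).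
by apply: eq_bigr => T _; rewrite norm1_sqr.
Qed.

(** ** The two-scale bilinear form *)

Lemma BB_linear c u v w : B (c *: u + v) w = c * B u w + B v w.
Proof.
rewrite /BB -/(glue _) -/(glue u) -/(glue v) glue_linear (formPl aP).
rewrite mulrDr addrACA; congr (_ + _).
rewrite mulrCA -mulrDr; congr (_ * _); rewrite mulr_sumr -big_split/=.
apply: eq_bigr => T _; rewrite !ffunE (formPl aP) (formPl (aTP T)); ring.
Qed.

(** By the corrector equations [B] is an inner product of energy type, whose
    first argument has squared norm [energy_form u u]. *)
Lemma BBE u v : VV v ->
  B u v = product_form a (glue u, [ffun T => - Num.sqrt rho *: defect u T]) v.
Proof.
move=> [_ vW]; rewrite /BB /product_form /=; congr (_ + _).
rewrite mulr_sumr; apply: eq_bigr => T _.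
rewrite ffunE scaleNr (formNl aP) (formZl aP) -mulrN -(formNl aP) opprB.
by rewrite (formBl aP) (correctorE _ (vW T)).
Qed.

Lemma BB_bounded u v : VV v -> `|B u v| <= Num.sqrt beta * nnorma u * nnorm1 v.
Proof.
move=> vV; rewrite BBE//.
apply: le_trans (form_CS (product_formP aP) _ _) _.
rewrite [_ * nnorma u]mulrC -mulrA ler_pM ?seminorm_of_ge0//.
  rewrite nnormaE /seminorm_of ler_wsqrtr// /product_form /energy_form /=.
  rewrite lerD2l mulr_sumr ler_sum// => T _.
  rewrite ffunE (formZl aP) (formZr aP) mulrA mulrNN -expr2 sqr_sqrtr//.
rewrite nnorm1E -sqrtrM ?(ltW beta_gt0)// ler_wsqrtr// /product_form mulrDr.
by rewrite lerD// mulr_sumr ler_sum.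
Qed.

(** ** The inf-sup condition *)

Hypothesis VH_nontrivial : exists2 v, VH v & v <> 0.
Hypothesis gammaE : gamma = gammak S TH A Ahalf Q.
Hypothesis gamma_gt0 : 0 < gamma.
Hypothesis gamma_le : gamma <= Num.sqrt alpha.

Lemma VH0 : VH 0.
Proof.
by have [v h _] := VH_nontrivial; have := VH_comb (-1) h h; rewrite scaleN1r addNr.
Qed.

Lemma VH_sub u v : VH u -> VH v -> VH (u - v).
Proof. by move=> h1 h2; have := VH_comb (-1) h2 h1; rewrite scaleN1r addrC. Qed.

Lemma VV_sub u v : VV u -> VV v -> VV (u - v).
Proof.
move=> [uH uW] [vH vW]; split; first exact: VH_sub.
by move=> T; rewrite !ffunE; exact: W_sub.
Qed.

Lemma VV_coarse x : VH x -> VV (x, [ffun=> 0]).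
Proof. by move=> xH; split=> [|T]; [exact: xH|rewrite ffunE; exact: W0]. Qed.

Lemma VV_opp u : VV u -> VV (- u).
Proof. by rewrite -[- u]sub0r; apply: VV_sub; exact: VV_coarse VH0. Qed.

(** A test function for any threshold below [gamma].  Both norms are positive
    because the quotient exceeds [g > 0], whereas division by zero yields 0. *)
Lemma inf_sup_test w g : VH w -> w <> 0 -> 0 < g < gamma ->
  exists v, [/\ VH v, 0 < n1 v, 0 < na (w - Qs w)
    & g * na (w - Qs w) <= a (w - Qs w) v / n1 v].
Proof.
move=> wH w0 /andP[g0 gg].
set E := [set a (w - Qs w) v / (norma S Ahalf (w - Qs w) * norm1 S v)
  | v in [set v | VH v /\ v <> 0]].
have gE : gamma <= sup E.
  rewrite gammaE; apply: ge_inf; last by exists w.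
  exists 0 => _ [x _ <-]; apply: sup_sym_ge0.
  have [v vH v0] := VH_nontrivial.
  exists (a (x - Qs x) v / (norma S Ahalf (x - Qs x) * norm1 S v)); first by exists v.
  exists (- v); first split.
  - by have := VH_comb (-1) vH VH0; rewrite scaleN1r addr0.
  - by move/eqP; rewrite oppr_eq0 => /eqP.
  by rewrite (formNr aP) mulNr !norm1E (seminorm_ofN i1P).
have [_ [v [vH v0] <-] h] : exists2 x, E x & g < x.
  apply: sup_gt; last exact: lt_le_trans gE.
  by have [v vH v0] := VH_nontrivial; eexists; exists v.
move: h; rewrite normaE.
have [->|nw0] := eqVneq (na (w - Qs w)) 0.
  by rewrite mul0r invr0 mulr0 ltNge ltW.
have nwp : 0 < na (w - Qs w) by rewrite lt_def nw0 seminorm_of_ge0.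
rewrite norm1E; have [->|nv0] := eqVneq (n1 v) 0.
  by rewrite mulr0 invr0 mulr0 ltNge ltW.
have nvp : 0 < n1 v by rewrite lt_def nv0 sqrtr_ge0.
move=> h; exists v; split => //.
move: h; rewrite -(ltr_pM2r nwp) => /ltW/le_trans; apply.
by rewrite le_eqVlt; apply/orP; left; apply/eqP; field; rewrite nv0 nw0.
Qed.

Lemma Qsum_linear c u v z : a (Qs (c *: u + v)) z = c * a (Qs u) z + a (Qs v) z.
Proof.
rewrite /Qsum !(form_suml aP) mulr_sumr -big_split/=.
by apply: eq_bigr => T _; exact: a_corrector_linear.
Qed.

(** The inf-sup condition forces the Galerkin solution to be unique. *)
Lemma VH_eq u v : VH u -> VH v ->
  (forall z, VH z -> a (u - Qs u) z = a (v - Qs v) z) -> u = v.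
Proof.
move=> uH vH h; apply/eqP; rewrite -subr_eq0; apply/negP => /negP/eqP uv.
have gg : 0 < gamma / 2 < gamma by rewrite divr_gt0//= ltr_pdivrMr// ltr_pMr// ltr1n.
have [z [zH z1 zw hz]] := inf_sup_test (VH_sub uH vH) uv gg.
move: hz; rewrite (_ : a _ z = 0).
  by rewrite mul0r leNgt mulr_gt0// (proj1 (andP gg)).
have := Qsum_linear (-1) v u z; rewrite scaleN1r [- v + u]addrC => hQ.
have := h z zH; rewrite !(formBl aP) hQ.
move: (a u z) (a v z) (a (Qs u) z) (a (Qs v) z) => ? ? ? ?; lra.
Qed.

Lemma glueE uu : glue uu = (uu.1 - Qs uu.1) + \sum_T defect uu T.
Proof. by rewrite /glue /defect sumrB /Qsum addrA subrK. Qed.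

Lemma overlap_defect uu : VV uu ->
  beta * a (\sum_T defect uu T) (\sum_T defect uu T) <=
  alpha * (rho * \sum_T a (defect uu T) (defect uu T)).
Proof.
move=> [_ uW]; rewrite mulrA alpha_rho -mulrA ler_pM2l//.
by apply: overlap => T; apply: W_sub => //; exact: corrector_in.
Qed.

(** The test function [(0, - defects)] bounds the defects, hence their sum; coarse
    test functions bound the glued function up to that sum, by the oblique
    projection.  The bound [gamma <= sqrt alpha] makes the two scales match. *)
Lemma BB_inf_sup u s : VV u -> 0 <= s ->
  (forall v, VV v -> B u v <= s * nnorm1 v) ->
  gamma * nnorma u <= Num.sqrt 5 * s.
Proof.
move=> uV s0 hs; have [uH uW] := uV.
have dW T : W T (defect u T) by apply: W_sub => //; exact: corrector_in.
set Y := \sum_T a (defect u T) (defect u T).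
have Y0 : 0 <= Y by apply: sumr_ge0 => T _; exact: (form_ge0 aP).
have hY : alpha * (rho * Y) <= s ^+ 2.
  pose v : two_scale := (0, [ffun T => - defect u T]).
  have vV : VV v by split => [|T]; [exact: VH0|rewrite ffunE; exact: W_opp].
  have := hs v vV; rewrite BBE// /product_form /= (form0r aP) add0r.
  under eq_bigr do rewrite !ffunE scaleNr (formNl aP) (formNr aP) opprK (formZl aP).
  rewrite -mulr_sumr -/Y => h.
  have hv : nnorm1 v <= Num.sqrt (Y / alpha).
    rewrite nnorm1E ler_wsqrtr// /product_form /= (form0l i1P) add0r.
    rewrite ler_pdivlMr// mulr_suml ler_sum// => T _.
    by rewrite ffunE (formNl i1P) (formNr i1P) opprK mulrC.
  have := le_trans h (ler_wpM2l s0 hv).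
  rewrite -(@ler_pXn2r _ 2)// ?nnegrE ?mulr_ge0 ?sqrtr_ge0//.
  rewrite !exprMn !sqr_sqrtr// ?divr_ge0 ?(ltW alpha_gt0)//.
  have [->|Yn] := eqVneq Y 0; first by move=> _; rewrite !mulr0 sqr_ge0.
  have Yp : 0 < Y by rewrite lt_def Yn.
  move=> /(ler_wpM2l (ltW alpha_gt0)) h2; rewrite -(ler_pM2r Yp).
  rewrite (_ : s ^+ 2 * Y = alpha * (s ^+ 2 * (Y / alpha))); last first.
    by field; rewrite gt_eqF.
  by apply: le_trans h2; rewrite expr2 !mulrA.
have hr := overlap_defect uV; rewrite -/Y in hr.
set r := \sum_T defect u T in hr.
have hrs : Num.sqrt beta * na r <= s.
  rewrite -(@ler_pXn2r _ 2)// ?nnegrE ?mulr_ge0 ?sqrtr_ge0//.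
  rewrite exprMn (sqr_seminorm_of aP) sqr_sqrtr ?(ltW beta_gt0)//.
  exact: le_trans hY.
have ab : Num.sqrt alpha <= Num.sqrt beta by rewrite ler_wsqrtr.
have key : gamma * na (glue u) <= 2 * s.
  (* Test functions exist only below [gamma]: pick [g] between the quotient
     [2 * s / na (glue u)] and [gamma]. *)
  rewrite leNgt; apply/negP => hlt.
  have gp : 0 < na (glue u).
    rewrite lt_def seminorm_of_ge0 andbT; apply/eqP => g0; move: hlt.
    by rewrite g0 mulr0 ltNge mulr_ge0.
  pose g := (gamma + 2 * s / na (glue u)) / 2.
  have q0 : 0 <= 2 * s / na (glue u) by rewrite divr_ge0 ?mulr_ge0// ltW.
  have q1 : 2 * s / na (glue u) < gamma by rewrite ltr_pdivrMr.
  have gg : 0 < g < gamma by rewrite /g; apply/andP; split; lra.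
  have gs : 2 * s < g * na (glue u) by rewrite -ltr_pdivrMr// /g; lra.
  move: gs; apply/negP; rewrite -leNgt.
  have [u0|u0] := pselect (u.1 = 0).
    have w0 : na (u.1 - Qs u.1) = 0.
      rewrite u0 sub0r (seminorm_ofN aP) /seminorm_of.
      have := Qsum_linear 1 0 0 (Qs 0); rewrite scaler0 addr0 => h.
      by rewrite (_ : a _ _ = 0) ?sqrtr0//; lra.
    have : na (glue u) <= na r.
      rewrite glueE; apply: le_trans (ler_seminorm_ofD aP _ _) _.
      by rewrite w0 add0r.
    move=> hg; apply: (@le_trans _ _ s); last by lra.
    apply: le_trans hrs; apply: ler_pM => //; first by case/andP: gg => /ltW.
    - by rewrite seminorm_of_ge0.
    - by case/andP: gg => _ /ltW h; exact: le_trans h (le_trans gamma_le ab).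
  have [v [vH v1 wp hw]] := inf_sup_test uH u0 gg.
  have ex x : VH x -> a (glue u) x <= s * n1 x.
    move=> xH; pose vv : two_scale := (x, [ffun T => 0]).
    have vvV : VV vv by exact: VV_coarse.
    have z0 b F : semi_inner b -> \sum_T b (F T) (vv.2 T) = 0.
      by move=> bP; apply: big1 => T _; rewrite ffunE (form0r bP).
    have := hs vv vvV; rewrite BBE// nnorm1E /seminorm_of /product_form.
    by rewrite !z0// !addr0.
  pose l (y : Vh) := a y v / n1 v.
  have ll : forall c y z, l (c *: y + z) = c * l y + l z.
    by move=> c y z; rewrite /l (formPl aP); ring.
  have lb : forall y, `|l y| <= Num.sqrt beta * na y.
    move=> y; rewrite /l normrM normfV [`|n1 v|]ger0_norm ?seminorm_of_ge0//.
    rewrite ler_pdivrMr//; apply: le_trans (form_CS aP _ _) _.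
    rewrite [_ * na y]mulrC -mulrA ler_wpM2l ?seminorm_of_ge0//.
    by rewrite -sqrtrM ?(ltW beta_gt0)// ler_wsqrtr.
  have g0 : 0 < g by case/andP: gg.
  have hob := oblique_projection_bound aP ll lb g0 r wp hw.
  rewrite -glueE in hob; apply: (le_trans hob); rewrite /l.
  rewrite mulr_natl mulr2n lerD// {hob}.
  rewrite normrM normfV [`|n1 v|]ger0_norm ?seminorm_of_ge0// ler_pdivrMr//.
  rewrite ler_norml ex// andbT lerNl -(formNr aP) -(seminorm_ofN i1P) ex//.
  by have := VH_comb (-1) vH VH0; rewrite scaleN1r addr0.
rewrite -(@ler_pXn2r _ 2)// ?nnegrE ?mulr_ge0 ?sqrtr_ge0// ?(ltW gamma_gt0)//.
rewrite !exprMn nnormaE (sqr_seminorm_of energy_formP) sqr_sqrtr// /energy_form -/Y.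
have : (gamma * na (glue u)) ^+ 2 <= (2 * s) ^+ 2.
  by rewrite ler_pXn2r// ?nnegrE ?mulr_ge0 ?seminorm_of_ge0// ltW.
rewrite !exprMn (sqr_seminorm_of aP) => h.
have g2 : gamma ^+ 2 <= alpha.
  rewrite -[leRHS]sqr_sqrtr ?(ltW alpha_gt0)//.
  by rewrite ler_pXn2r// ?nnegrE ?sqrtr_ge0// ltW.
have : gamma ^+ 2 * (rho * Y) <= alpha * (rho * Y) by rewrite ler_wpM2r// mulr_ge0.
rewrite mulrDr; lra.
Qed.

(** ** Residual minimization *)

Hypothesis CI_bound : forall v, norm1 S (IH v) <= CI * norm1 S v.
Hypothesis IH_proj : forall v, VH v -> IH v = v.

Section solution.
Variables (uHk : Vh) (umu : two_scale).
Hypothesis uHkP : is_PGLOD_solution S TH A f Q uHk.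
Hypothesis umuP : is_two_scale_solution S TH k IH A f rho umu.
Local Notation residual := (residual S TH k IH A f rho).

Lemma BB_opp u v : VV v -> B u (- v) = - B u v.
Proof.
by move=> vV; rewrite (BBE _ vV) (BBE _ (VV_opp vV)) (formNr (product_formP aP)).
Qed.

Lemma BB_sub u v w : B (u - v) w = B u w - B v w.
Proof. by rewrite addrC -scaleN1r BB_linear mulN1r addrC. Qed.

Lemma residual_quotient uu vv : VV vv ->
  (FF S f vv - B uu vv) / nnorm1 vv = B (umu - uu) vv / nnorm1 vv.
Proof. by move=> vvV; rewrite BB_sub (proj2 umuP). Qed.

Lemma BB_quotient_le u v : VV v ->
  B u v / nnorm1 v <= Num.sqrt beta * nnorma u.
Proof.
move=> vV; have [v0|v0] := eqVneq (nnorm1 v) 0.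
  by rewrite v0 invr0 mulr0 mulr_ge0 ?sqrtr_ge0.
rewrite ler_pdivrMr ?lt_def ?v0 ?sqrtr_ge0//.
exact: le_trans (ler_norm _) (BB_bounded _ vV).
Qed.

Lemma residual_ub uu : ubound [set (FF S f vv - B uu vv) / nnorm1 vv
    | vv in [set vv : two_scale | VV vv /\ vv <> 0]]
  (Num.sqrt beta * nnorma (umu - uu)).
Proof.
by move=> _ [vv [vvV _] <-]; rewrite residual_quotient//; exact: BB_quotient_le.
Qed.

Lemma residual_le uu : residual uu <= Num.sqrt beta * nnorma (umu - uu).
Proof.
apply: ge_sup; last exact: residual_ub.
have [v vH v0] := VH_nontrivial.
eexists; exists (v, [ffun=> 0]); last by [].
by split; [exact: VV_coarse|case].
Qed.

Lemma residual_ge0 uu : 0 <= residual uu.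
Proof.
have [v vH v0] := VH_nontrivial.
pose vv : two_scale := (v, [ffun=> 0]).
have vvV : VV vv by exact: VV_coarse.
have nV := VV_opp vvV.
apply: sup_sym_ge0; exists (B (umu - uu) vv / nnorm1 vv).
  by exists vv; [split => //; case|exact: residual_quotient].
exists (- vv).
  by split => //; case=> /eqP; rewrite oppr_eq0 => /eqP.
rewrite residual_quotient// BB_opp// mulNr !nnorm1E.
by rewrite (seminorm_ofN (product_formP i1P)).
Qed.

Lemma residual_test uu vv : VV vv ->
  B (umu - uu) vv <= residual uu * nnorm1 vv.
Proof.
move=> vvV; have [n0|n0] := eqVneq (nnorm1 vv) 0.
  have := BB_bounded (umu - uu) vvV; rewrite n0 !mulr0.
  exact: le_trans (ler_norm _).
have np : 0 < nnorm1 vv by rewrite lt_def n0 sqrtr_ge0.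
have vv0 : vv <> 0.
  move=> v0; move/eqP: n0; apply; rewrite v0 nnorm1E /seminorm_of.
  by rewrite (form0l (product_formP i1P)) sqrtr0.
rewrite -ler_pdivrMr// -residual_quotient//; apply: ub_le_sup.
  by exists (Num.sqrt beta * nnorma (umu - uu)); exact: residual_ub.
by exists vv.
Qed.

(** The residual is a dual norm of the error, hence equivalent to its energy
    norm; minimizing it is quasi-optimal with the quotient of the constants. *)
Lemma residual_quasi_optimal ubar vv : VV ubar -> residual ubar <= residual vv ->
  nnorma (umu - ubar) <=
    Num.sqrt 5 * gamma^-1 * Num.sqrt beta * nnorma (umu - vv).
Proof.
move=> uV hle.
have := BB_inf_sup (VV_sub (proj1 umuP) uV) (residual_ge0 ubar)
  (fun v => @residual_test ubar v).
rewrite mulrC -ler_pdivlMr// => /le_trans; apply.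
rewrite -!mulrA ler_wpM2l ?sqrtr_ge0// mulrC ler_pM2l ?invr_gt0//.
exact: le_trans hle (residual_le _).
Qed.

(** ** The exact solution *)

Lemma load0 : load S f 0 = 0.
Proof.
rewrite /load /Rintegral integral0_eq// => x _.
have := fval_linear S (-1) 0 0 x.
by rewrite scaleN1r addNr mulN1r addNr => ->; rewrite mulr0.
Qed.

(** If [rho = 0] the fine-scale equations drop out of [B]; but then [C = 0], and
    the overlap bound makes every fine-scale vector null. *)
Lemma exact_defect_null T : a (defect umu T) (defect umu T) = 0.
Proof.
have [[uH uW] hB] := umuP.
have dW : W T (defect umu T) by apply: W_sub => //; exact: corrector_in.
have [rho0|rho0] := eqVneq rho 0.
  have := @overlap (fun T' => if T' == T then defect umu T else 0).
  have C0 : C%:R = 0 :> R.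
    move/eqP: rho0; rewrite rhoE mulf_eq0 => /orP[/eqP//|/eqP k0].
    by have := kappa_ge1; rewrite k0 ler10.
  rewrite C0 mul0r (bigD1 T)//= eqxx big1 ?addr0; last by move=> i /negPf ->.
  move=> h; apply/le_anti; rewrite (form_ge0 aP) andbT; apply: h => T'.
  by case: eqP => [->//|_]; exact: W0.
pose vv : two_scale := (0, [ffun T' => if T' == T then defect umu T else 0]).
have vvV : VV vv.
  by split; [exact: VH0|move=> T' /=; rewrite ffunE; case: eqP => [->//|_]; exact: W0].
have := hB vv vvV; rewrite BBE// /FF load0 /product_form /= (form0r aP) add0r.
rewrite (bigD1 T)//= !ffunE eqxx big1 ?addr0; last first.
  by move=> i /negPf iT; rewrite !ffunE iT (form0r aP).
rewrite scaleNr (formNl aP) (formZl aP) => /eqP; rewrite oppr_eq0 mulf_eq0.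
by rewrite sqrtr_eq0 leNgt lt_def rho0 rho_ge0 => /eqP.
Qed.

Lemma exact_coarse : umu.1 = uHk.
Proof.
have [[uH uW] hB] := umuP; have [kH hk] := uHkP.
apply: VH_eq => // z zH; rewrite hk//.
pose vv : two_scale := (z, [ffun=> 0]).
have vvV : VV vv by exact: VV_coarse.
have := hB vv vvV; rewrite BBE// /product_form /= big1 ?addr0; last first.
  by move=> T _; rewrite !ffunE (form0r aP).
rewrite /FF /= => <-; rewrite glueE [RHS](formDl aP) (form_suml aP) big1 ?addr0// => T _.
exact: (form_null aP _ (exact_defect_null T)).
Qed.

Lemma err1E vv : err1 S Q rho uHk vv = seminorm_of h1_form (umu - vv).
Proof.
rewrite /err1 /seminorm_of /h1_form norm1_sqr /= -exact_coarse.
congr (Num.sqrt (_ + _ * _)); apply: eq_bigr => T _; rewrite norm1_sqr.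
have ab := i1_null.
have n0 z : i1 (defect umu T) z = 0.
  by apply: (form_null i1P); apply: i1_null; exact: exact_defect_null.
have e z : i1 (defect (umu - vv) T) z = - i1 (defect vv T) z.
  rewrite addrC -scaleN1r (defect_linear i1P ab) n0; ring.
by rewrite e (formC i1P) e opprK.
Qed.

(** ** Equivalence of the two error measures *)

(** Some coarse function has positive norm, by [gamma > 0], and the
    quasi-interpolation reproduces it. *)
Lemma quasi_interpolation_bound_ge1 : 1 <= CI.
Proof.
have [w wH w0] := VH_nontrivial.
have gg : 0 < gamma / 2 < gamma.
  by rewrite divr_gt0//= ltr_pdivrMr// ltr_pMr// ltr1n.
have [v [vH v1 _ _]] := inf_sup_test wH w0 gg.
have := CI_bound v; rewrite IH_proj// norm1E -[X in X <= _]mul1r.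
by rewrite ler_pM2r.
Qed.

(** The quasi-interpolation recovers the coarse part from the glued function,
    since it annihilates the fine-scale parts. *)
Lemma h1_le_energy u : VV u ->
  seminorm_of h1_form u <= CI / Num.sqrt alpha * nnorma u.
Proof.
move=> [uH uW]; have CI1 := quasi_interpolation_bound_ge1.
have CI0 : 0 <= CI by exact: le_trans ler01 CI1.
rewrite nnormaE -(@ler_pXn2r _ 2)// ?nnegrE ?mulr_ge0 ?invr_ge0 ?sqrtr_ge0//.
rewrite !exprMn exprVn (sqr_sqrtr (ltW alpha_gt0)).
rewrite (sqr_seminorm_of h1_formP) (sqr_seminorm_of energy_formP).
have i1a v : i1 v v <= a v v / alpha by rewrite ler_pdivlMr// mulrC.
rewrite /h1_form /energy_form mulrDr lerD//.
  have gE : IH (glue u) = u.1.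
    rewrite /glue linearB linear_sum/= IH_proj// big1 ?subr0// => T _.
    by have [] := uW T.
  have : norm1 S u.1 ^+ 2 <= (CI * norm1 S (glue u)) ^+ 2.
    by rewrite ler_pXn2r// ?nnegrE ?mulr_ge0 ?sqrtr_ge0// -{1}gE.
  rewrite exprMn !norm1_sqr => /le_trans; apply.
  by rewrite -mulrA ler_wpM2l ?sqr_ge0// mulrC; exact: i1a.
set X := \sum_T i1 _ _; set Y := \sum_T a _ _.
have XY : X <= Y / alpha by rewrite mulr_suml ler_sum.
have Y0 : 0 <= Y by apply: sumr_ge0 => T _; exact: (form_ge0 aP).
apply: (@le_trans _ _ (rho * (Y / alpha))); first by rewrite ler_wpM2l.
rewrite (_ : CI ^+ 2 / alpha * (rho * Y) = CI ^+ 2 * (rho * (Y / alpha))); last by ring.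
have P0 : 0 <= rho * (Y / alpha) by rewrite mulr_ge0 ?divr_ge0 ?(ltW alpha_gt0).
rewrite ler_peMl//.
by rewrite -[X in X <= _](expr1n _ 2) ler_pXn2r// ?nnegrE.
Qed.

(** Splitting into the coarse part, its corrector and the defects costs the
    factor 3. *)
Lemma energy_le_h1 u : VV u ->
  nnorma u <= Num.sqrt (3 * (C%:R + 1) * beta) * seminorm_of h1_form u.
Proof.
move=> [uH uW]; have dW T : W T (defect u T).
  by apply: W_sub => //; exact: corrector_in.
have C0 : 0 <= C%:R :> R by [].
have b0 := ltW beta_gt0.
rewrite nnormaE -(@ler_pXn2r _ 2)// ?nnegrE ?mulr_ge0 ?sqrtr_ge0//.
have k0 : 0 <= 3 * (C%:R + 1) * beta by rewrite !mulr_ge0// addr_ge0.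
rewrite exprMn (sqr_sqrtr k0).
rewrite (sqr_seminorm_of energy_formP) (sqr_seminorm_of h1_formP).
rewrite /energy_form /h1_form.
set X := \sum_T i1 _ _; set Y := \sum_T a _ _.
have X0 : 0 <= X by apply: sumr_ge0 => T _; exact: (form_ge0 i1P).
have XY : Y <= beta * X by rewrite mulr_sumr ler_sum.
have h1 : a (glue u) (glue u) <=
    3 * (a u.1 u.1 + C%:R * a u.1 u.1 + C%:R * Y).
  rewrite glueE; apply: le_trans (form_sqrD3_le aP _ _ _) _; rewrite ler_pM2l//.
  rewrite lerD ?overlap// lerD2l (formNl aP) (formNr aP) opprK.
  apply: le_trans (overlap (fun T => corrector_in T u.1)) _.
  by rewrite ler_wpM2l// sum_corrector_le.
(* For [C = 0] both sides vanish, and for [C >= 1] one has [rho >= C]. *)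
have h2 : 3 * C%:R + rho <= 3 * (C%:R + 1) * rho.
  rewrite rhoE; have := kappa_ge1; case: (C) => [|n]; first by lra.
  have n0 : 0 <= n%:R :> R by [].
  by rewrite -natr1 => k1; nra.
have h3 := a_upper u.1.
have h4 : (3 * C%:R + rho) * Y <= 3 * (C%:R + 1) * rho * (beta * X).
  apply: ler_pM => //; first by rewrite addr_ge0// mulr_ge0.
  by apply: sumr_ge0 => T _; exact: (form_ge0 aP).
have h5 : 3 * (C%:R + 1) * a u.1 u.1 <= 3 * (C%:R + 1) * (beta * i1 u.1 u.1).
  by rewrite ler_wpM2l// mulr_ge0// addr_ge0.
lra.
Qed.

Lemma two_scale_quasi_optimality (VVbar : {vspace two_scale}) (ubar : two_scale) :
  (forall vv, vv \in VVbar -> VV vv) ->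
  is_residual_minimizer S TH k IH A f rho VVbar ubar ->
  (exists2 m, is_minimum [set nnorma (umu - vv) | vv in [set` VVbar]] m
    & nnorma (umu - ubar) <= Num.sqrt 5 * gamma^-1 * Num.sqrt beta * m)
  /\
  (exists2 m, is_minimum [set err1 S Q rho uHk vv | vv in [set` VVbar]] m
    & err1 S Q rho uHk ubar
      <= Num.sqrt 15 * CI * Num.sqrt (C%:R + 1) * Num.sqrt kappa
         * gamma^-1 * Num.sqrt beta * m).
Proof.
move=> hV [ubarV hmin].
have opt vv : vv \in VVbar -> nnorma (umu - ubar) <=
    Num.sqrt 5 * gamma^-1 * Num.sqrt beta * nnorma (umu - vv).
  by move=> vvV; apply: residual_quasi_optimal; [exact: hV|exact: hmin].
split.
  have [p pV pmin] := ex_best_approximation energy_formP VVbar umu.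
  exists (nnorma (umu - p)); last exact: opt.
  split; first by exists p.
  by move=> _ [v vV <-]; rewrite !nnormaE; exact: pmin.
have [p pV pmin] := ex_best_approximation h1_formP VVbar umu.
exists (err1 S Q rho uHk p).
  split; first by exists p.
  by move=> _ [v vV <-]; rewrite !err1E; exact: pmin.
have dV v : v \in VVbar -> VV (umu - v).
  by move=> vV; apply: VV_sub; [case: umuP|exact: hV].
rewrite !err1E; apply: le_trans (h1_le_energy (dV _ ubarV)) _.
have CI0 : 0 <= CI by exact: le_trans ler01 quasi_interpolation_bound_ge1.
apply: le_trans (ler_wpM2l _ (opt _ pV)) _; first by rewrite divr_ge0 ?sqrtr_ge0.
have g0 : 0 <= gamma^-1 by rewrite invr_ge0 ltW.
apply: le_trans (_ : CI / Num.sqrt alpha * (Num.sqrt 5 * gamma^-1 * Num.sqrt beta *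
    (Num.sqrt (3 * (C%:R + 1) * beta) * seminorm_of h1_form (umu - p))) <= _).
  rewrite ler_wpM2l ?divr_ge0 ?sqrtr_ge0// ler_wpM2l ?mulr_ge0 ?sqrtr_ge0//.
  exact: energy_le_h1 (dV _ pV).
have C0 : 0 <= C%:R + 1 :> R by rewrite addr_ge0.
rewrite (_ : 15 = 5 * 3 :> R); last by lra.
rewrite kappaE !sqrtrM ?mulr_ge0// ?(ltW beta_gt0)// sqrtrV ?(ltW alpha_gt0)//.
by rewrite le_eqVlt; apply/orP; left; apply/eqP; ring.
Qed.

End solution.
End two_scale.

Theorem theorem4p8 (R : realType) (p d : nat)
  (P : set 'rV[R]_p) (Omega : set 'rV[R]_d.+1)
  (hOmega : lipschitz_domain Omega) (bOmega : bounded_set Omega)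
  (f : 'rV[R]_d.+1 -> R) (hf : L2 Omega f)
  (alpha beta kappa : R) (alpha_gt0 : 0 < alpha) (le_alpha_beta : alpha <= beta)
  (hkappa : kappa = beta / alpha)
  (A Ahalf : 'rV[R]_p -> 'rV[R]_d.+1 -> 'M[R]_d.+1)
  (hA : forall mu, P mu -> elliptic_field Omega alpha beta (A mu))
  (hAhalf : forall mu, P mu -> forall x, Omega x ->
     is_sqrt (Ahalf mu x) (A mu x))
  (M N : nat) (Th : 'I_M -> set 'rV[R]_d.+1) (TH : 'I_N -> set 'rV[R]_d.+1)
  (hTh : is_mesh Omega Th) (sigma : R) (sTh : shape_regular sigma Th)
  (hTH : is_mesh Omega TH) (hTHTh : aligned TH Th)
  (Vh : vectType R) (S : H10_subspace Omega Vh) (hVh : finite_element S Th)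
  (hVH : exists2 v, VH S TH v & v <> 0)
  (k : nat)
  (IH : {linear Vh -> Vh}) (CI : R)
  (hIH : forall v, VH S TH (IH v))
  (hIHproj : forall v, VH S TH v -> IH v = v)
  (hIHbound : forall v, norm1 S (IH v) <= CI * norm1 S v)
  (mu : 'rV[R]_p) (hmu : P mu)
  (Q : 'I_N -> Vh -> Vh) (hQ : is_corrector S TH k IH (A mu) Q)
  (gamma : R) (hgamma : gamma = gammak S TH (A mu) (Ahalf mu) Q)
  (gamma_gt0 : 0 < gamma) (le_gamma_alpha : gamma <= Num.sqrt alpha)
  (uHk : Vh) (huHk : is_PGLOD_solution S TH (A mu) f Q uHk)
  (Covl rho : R) (hCovl : Covl = (ovl_const Omega TH k)%:R)
  (hrho : rho = Covl * kappa)
  (VVbar : {vspace (Vh * {ffun 'I_N -> Vh})%type})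
  (hVVbar : forall vv, vv \in VVbar -> VV S TH k IH vv)
  (ubar : Vh * {ffun 'I_N -> Vh})
  (hubar : is_residual_minimizer S TH k IH (A mu) f rho VVbar ubar)
  (umu : Vh * {ffun 'I_N -> Vh})
  (humu : is_two_scale_solution S TH k IH (A mu) f rho umu) :
  (exists2 m, is_minimum
      [set nnorma S (Ahalf mu) Q rho (umu - vv) | vv in [set` VVbar]] m
    & nnorma S (Ahalf mu) Q rho (umu - ubar)
      <= Num.sqrt 5 * gamma^-1 * Num.sqrt beta * m)
  /\
  (exists2 m, is_minimum [set err1 S Q rho uHk vv | vv in [set` VVbar]] m
    & err1 S Q rho uHk ubar
      <= Num.sqrt 15 * CI * Num.sqrt (Covl + 1) * Num.sqrt kappa
         * gamma^-1 * Num.sqrt beta * m).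
Proof.
have [oO _ _ _] := hOmega.
have [TH_el trivTH _ _] := hTH.
have oT i : open (TH i) by have [] := TH_el i.
have TO i : TH i `<=` Omega by have [] := TH_el i.
have mT i : measurable (TH i) by exact: open_measurable_rV.
have mO : measurable Omega by exact: open_measurable_rV.
have hAmu := hA mu hmu; have alpha_ge0 := ltW alpha_gt0.
have bA := elliptic_bounded_field oO alpha_ge0 hAmu.
rewrite hCovl in hrho *.
apply: (two_scale_quasi_optimality (A := A mu) (alpha := alpha) (S := S) (TH := TH)
  (k := k) (IH := IH) (f := f)) => //.
- exact: aformP hAmu.
- exact: dirichletP.
- by move=> T; exact: aform_onP bA.
- by move=> v; apply: norma_aform; exact: hAhalf.
- by move=> v; have /andP[] := aform_bounds S oO alpha_ge0 hAmu v.
- by move=> v; have /andP[] := aform_bounds S oO alpha_ge0 hAmu v.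
- by move=> v; exact: (sum_aform_on_le S oO alpha_ge0 hAmu v mT trivTH TO).
- exact: VH_linear.
- by move=> T c u v; exact: VfT_linear.
- move=> w wW; apply: (aform_overlap oO alpha_ge0 hAmu
    (U := fun T => Defs.patch TH k (TH T))).
    by move=> x Ox; exact: ovl_count_le.
  move=> T; have [_ hT] := wW T.
  apply: (H10_gradient_off mO _ (fval_measurable S oO (w T)) _ hT).
    exact: patch_measurable.
  exact: fgrad_measurable.
Qed.
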